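(* Let $K$ be a field of characteristic $p>0$, let $A=K[[Y]]$ be the power series ring in one variable over $K$, and let $Q(A)$ be the field of fractions of $A$. Let $R=A[X_1,\ldots,X_n]$ be the standard $\mathbb{N}^n$-graded polynomial ring over $A$, i.e., $\deg(A)=\underline{0}\in\mathbb{N}^n$ and $\deg(X_j)=e_j\in\mathbb{N}^n$ for $j=1,\ldots,n$. Let $M=\bigoplus_{\underline{u}\in\mathbb{Z}^n}M_{\underline{u}}$ be a $\mathbb{Z}^n$-graded $\mathcal{F}$-finite $\mathcal{F}$-module over $R$. Then for every $\underline{u}\in\mathbb{Z}^n$ there are finite numbers $a(\underline{u}),b(\underline{u}),c(\underline{u})\geq 0$ (non-negative integers) and an isomorphism of $A$-modules $$M_{\underline{u}}\cong E(A/YA)^{a(\underline{u})}\oplus Q(A)^{b(\underline{u})}\oplus A^{c(\underline{u})},$$ where $E(A/YA)$ denotes the injective hull of $A/YA$ as an $A$-module.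
   Context: Here $e_j$ is the $j$-th standard basis vector of $\mathbb{Z}^n$. For a regular Noetherian ring $R$ of characteristic $p>0$, let $R^1$ be the $(R,R)$-bimodule which is $R$ as an additive group, with the usual left multiplication and with right multiplication through the Frobenius map $a\mapsto a^p$. The Frobenius functor is $\mathcal{F}(M)=R^1\otimes_R M$ on $R$-modules, with $\mathcal{F}(f)=\mathrm{id}\otimes f$; $\mathcal{F}^e$ denotes its $e$-th iterate. An $\mathcal{F}$-module over $R$ is an $R$-module $M$ with an $R$-module isomorphism $\theta:M\to\mathcal{F}(M)$. An $\mathcal{F}$-module is $\mathcal{F}$-finite if it is of the form $M=\varinjlim\left(U\xrightarrow{\beta}\mathcal{F}(U)\xrightarrow{\mathcal{F}(\beta)}\mathcal{F}^2(U)\to\cdots\right)$ for a finitely generated $R$-module $U$ and an $R$-linear map $\beta:U\to\mathcal{F}(U)$ (a generating morphism), with the structure isomorphism $M\cong\mathcal{F}(M)$ induced by shifting the direct system. If $R$ is $\mathbb{Z}^n$-graded and $M$ is a $\mathbb{Z}^n$-graded $R$-module, then $\mathcal{F}(M)$ is $\mathbb{Z}^n$-graded by $\deg(r\otimes m)=\deg(r)+p\deg(m)$ for homogeneous $r\in R$, $m\in M$. A $\mathbb{Z}^n$-graded $\mathcal{F}$-finite $\mathcal{F}$-module is one arising as such a direct limit with $U$ graded and $\beta$ degree preserving, with the induced grading on $M$. *)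

(* Defs.v *)
From HB Require Import structures.
From mathcomp Require Import all_boot all_algebra.
From mathcomp Require Import generic_quotient ring_quotient.
From mathcomp Require Import boolp.
From mathcomp Require Import freeg mpoly.

Set Implicit Arguments.
Unset Strict Implicit.
Unset Printing Implicit Defensive.

Import GRing.Theory.
Local Open Scope ring_scope.
Local Open Scope quotient_scope.

(* K[[Y]]: a series is its sequence of coefficients, with the Cauchy product. *)
Record powser (K : fieldType) := PowSer { coefs : nat -> K }.

Section PowerSeries.
Variable K : fieldType.
Implicit Types f g h : powser K.

HB.instance Definition _ := gen_eqMixin (powser K).
HB.instance Definition _ := gen_choiceMixin (powser K).

Lemma powserP f g : (forall k, coefs f k = coefs g k) -> f = g.
Proof. by case: f g => [f] [g] /= /funext ->. Qed.

Definition ps0 : powser K := PowSer (fun=> 0).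
Definition ps1 : powser K := PowSer (fun k => (k == 0%N)%:R).
Definition psX : powser K := PowSer (fun k => (k == 1%N)%:R).
Definition psadd f g := PowSer (fun k => coefs f k + coefs g k).
Definition psopp f := PowSer (fun k => - coefs f k).
Definition psmul f g :=
  PowSer (fun k => \sum_(i < k.+1) coefs f i * coefs g (k - i)).

Lemma psaddA : associative psadd.
Proof. by move=> f g h; apply: powserP => k /=; rewrite addrA. Qed.
Lemma psaddC : commutative psadd.
Proof. by move=> f g; apply: powserP => k /=; rewrite addrC. Qed.
Lemma psadd0 : left_id ps0 psadd.
Proof. by move=> f; apply: powserP => k /=; rewrite add0r. Qed.
Lemma psaddN : left_inverse ps0 psopp psadd.
Proof. by move=> f; apply: powserP => k /=; rewrite addNr. Qed.

HB.instance Definition _ :=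
  GRing.isZmodule.Build (powser K) psaddA psaddC psadd0 psaddN.

Let trunc N f : {poly K} := \poly_(i < N) coefs f i.

Let psmul_poly N f g (q r : {poly K}) k : (k < N)%N ->
  (forall i, (i < N)%N -> q`_i = coefs f i) ->
  (forall i, (i < N)%N -> r`_i = coefs g i) ->
  coefs (psmul f g) k = (q * r)`_k.
Proof.
move=> ltkN hq hr; rewrite coefM; apply: eq_bigr => i _ /=.
rewrite hq ?hr //; first exact: leq_ltn_trans (leq_subr _ _) ltkN.
by apply: leq_ltn_trans ltkN; rewrite -ltnS.
Qed.

Let coef_trunc N f i : (i < N)%N -> (trunc N f)`_i = coefs f i.
Proof. by move=> ltiN; rewrite coef_poly ltiN. Qed.

Lemma psmulA : associative psmul.
Proof.
move=> f g h; apply: powserP => k; pose t := trunc k.+1.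
rewrite (@psmul_poly k.+1 f (psmul g h) (t f) (t g * t h)) //.
- rewrite (@psmul_poly k.+1 (psmul f g) h (t f * t g) (t h)) ?mulrA //.
  + by move=> i lti; apply/esym/(@psmul_poly k.+1) => // j; apply: coef_trunc.
  + by move=> i; apply: coef_trunc.
- by move=> i; apply: coef_trunc.
- by move=> i lti; apply/esym/(@psmul_poly k.+1) => // j; apply: coef_trunc.
Qed.

Lemma psmulC : commutative psmul.
Proof.
move=> f g; apply: powserP => k; pose t := trunc k.+1.
rewrite (@psmul_poly k.+1 f g (t f) (t g)) //; try exact: coef_trunc.
rewrite (@psmul_poly k.+1 g f (t g) (t f)) //; try exact: coef_trunc.
by rewrite mulrC.
Qed.

Lemma psmul1 : left_id ps1 psmul.
Proof.
move=> f; apply: powserP => k /=; rewrite big_ord_recl /= mul1r subn0.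
by rewrite big1 ?addr0 // => i _; rewrite mul0r.
Qed.

Lemma psmulDl : left_distributive psmul psadd.
Proof.
move=> f g h; apply: powserP => k /=; rewrite -big_split /=.
by apply: eq_bigr => i _; rewrite mulrDl.
Qed.

Lemma ps1_neq0 : ps1 != 0.
Proof. by apply/eqP => /(congr1 (fun q => coefs q 0)) /= /eqP; rewrite oner_eq0. Qed.

HB.instance Definition _ := GRing.Zmodule_isComNzRing.Build (powser K)
  psmulA psmulC psmul1 psmulDl ps1_neq0.

Definition psunit : pred (powser K) := fun f => coefs f 0 != 0.

(* If f = c (1 - h) with c != 0 and h of order > 0, the k-th coefficient of
   1 / (1 - h) is that of the finite sum 1 + h + ... + h ^ k. *)
Definition psinv f : powser K :=
  if psunit f then
    let c := coefs f 0 in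
    let h : powser K := 1 - PowSer (fun k => c^-1 * coefs f k) in
    PowSer (fun k => c^-1 * coefs (\sum_(j < k.+1) h ^+ j) k)
  else f.

Let coefsD f g k : coefs (f + g) k = coefs f k + coefs g k. Proof. by []. Qed.
Let coefsN f k : coefs (- f) k = - coefs f k. Proof. by []. Qed.
Let coefsM f g k :
  coefs (f * g) k = \sum_(i < k.+1) coefs f i * coefs g (k - i).
Proof. by []. Qed.
Let coefs1 k : coefs 1 k = (k == 0%N)%:R. Proof. by []. Qed.

Let coefsX_small h k j : coefs h 0 = 0 -> (k < j)%N -> coefs (h ^+ j) k = 0.
Proof.
move=> h0; elim: j k => // j IHj k; rewrite ltnS => lekj.
rewrite exprS coefsM big_ord_recl /= h0 mul0r add0r big1 // => i _.
rewrite IHj ?mulr0 // /bump /= add1n; apply: leq_trans lekj.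
by case: k i => [[]//|k] i; rewrite subSS ltnS leq_subr.
Qed.

Let coefs_sumX h k N : coefs h 0 = 0 -> (k < N)%N ->
  coefs (\sum_(j < N) h ^+ j) k = coefs (\sum_(j < k.+1) h ^+ j) k.
Proof.
move=> h0 ltkN; rewrite -(subnKC ltkN); elim: (N - k.+1)%N => [|d IHd].
  by rewrite addn0.
by rewrite addnS big_ord_recr coefsD IHd coefsX_small ?addr0 // leq_addr.
Qed.

Lemma psmulV : {in psunit, left_inverse 1 psinv *%R}.
Proof.
move=> f uf; rewrite /psinv ifT //.
pose c := coefs f 0; pose f1 := PowSer (fun k => c^-1 * coefs f k).
rewrite -/c -/f1 /=; set h := 1 - f1.
have c0 : c != 0 by exact: uf.
have h0 : coefs h 0 = 0 by change (1 - c^-1 * c = 0); rewrite mulVf // subrr.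
have f1E : f1 = 1 - h by rewrite /h opprB addrC subrK.
move: h h0 f1E => h h0 f1E; apply: powserP => k; rewrite coefsM.
transitivity (coefs ((\sum_(j < k.+1) h ^+ j) * f1) k).
  rewrite coefsM; apply: eq_bigr => i _ /=.
  by rewrite (coefs_sumX h0 (ltn_ord i)) mulrCA mulrA.
have -> : (\sum_(j < k.+1) h ^+ j) * f1 = 1 - h ^+ k.+1.
  by rewrite f1E mulrC -[RHS]opprB subrX1 -mulNr opprB.
by rewrite coefsD coefsN coefsX_small // subr0.
Qed.

Lemma psunit_intro f g : g * f = 1 -> f \in psunit.
Proof.
move=> /(congr1 (fun q => coefs q 0)).
rewrite coefsM big_ord1 coefs1 /= => gf.
by apply/eqP => f0; move/eqP: gf; rewrite f0 mulr0 eq_sym oner_eq0.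
Qed.

Lemma psinv_out : {in [predC psunit], psinv =1 id}.
Proof. by move=> f /negbTE nuf; rewrite /psinv ifF. Qed.

HB.instance Definition _ := GRing.ComNzRing_hasMulInverse.Build (powser K)
  psmulV psunit_intro psinv_out.

Let order_ex f : f != 0 -> exists k, coefs f k != 0.
Proof.
apply: contra_neqP => fk0; apply: powserP => k; apply/eqP.
by apply: contra_notT fk0 => fk; exists k.
Qed.

Lemma psmul_eq0 : GRing.integral_domain_axiom (powser K).
Proof.
move=> f g fg0; apply: contra_eqT fg0; rewrite negb_or => /andP[f0 g0].
case: (ex_minnP (order_ex f0)) => a fa mina.
case: (ex_minnP (order_ex g0)) => b gb minb.
apply/eqP => /(congr1 (fun q => coefs q (a + b))) /eqP; rewrite coefsM.
have lta : (a < (a + b).+1)%N by rewrite ltnS leq_addr.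
rewrite (bigD1 (Ordinal lta)) //= big1 ?addr0.
  by rewrite addKn mulf_eq0 (negbTE fa) (negbTE gb).
move=> i; rewrite -val_eqE /= neq_ltn => /orP[ltia|ltai].
  suff /eqP -> : coefs f i == 0 by rewrite mul0r.
  by apply: contraTT ltia => /mina; rewrite -leqNgt.
suff /eqP -> : coefs g (a + b - i) == 0 by rewrite mulr0.
apply: contraTT ltai => /minb leb; rewrite -leqNgt -(leq_add2r b).
by rewrite -leq_subRL ?leq_sub // -ltnS ltn_ord.
Qed.

HB.instance Definition _ :=
  GRing.ComUnitRing_isIntegral.Build (powser K) psmul_eq0.
End PowerSeries.

Section Modules.
Variable R : comNzRingType.

Definition lmod_iso (V W : lmodType R) : Prop :=
  exists f : {linear V -> W}, bijective f.

Section Span.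
Variables (V : lmodType R) (B : V -> Prop).

Definition lspan (x : V) : Prop :=
  exists2 s : seq (R * V),
    (forall t, t \in s -> B t.2) & x = \sum_(t <- s) t.1 *: t.2.

Definition lspan_pred : V -> bool := fun x => `[< lspan x >].

Lemma lspan_closed : submod_closed lspan_pred.
Proof.
split; first by apply/asboolP; exists [::] => //; rewrite big_nil.
move=> a x y /asboolP[s sB ->] /asboolP[t tB ->]; apply/asboolP.
exists ([seq (a * z.1, z.2) | z <- s] ++ t).
  by move=> z; rewrite mem_cat => /orP[/mapP[w /sB wB ->]|/tB].
rewrite big_cat big_map /= scaler_sumr; congr (_ + _).
by apply: eq_bigr => z _; rewrite scalerA.
Qed.

Lemma lspan_gen x : B x -> lspan x.
Proof.
move=> Bx; exists [:: (1, x)]; last by rewrite big_seq1 scale1r.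
by move=> t; rewrite inE => /eqP ->.
Qed.

HB.instance Definition _ :=
  GRing.isSubmodClosed.Build R V lspan_pred lspan_closed.

Definition lspan_zmod : zmodClosed V := GRing.ZmodClosed.clone V lspan_pred _.

Definition lquot_type : Type := Quotient.quot lspan_zmod.

HB.instance Definition _ := GRing.Zmodule.on lquot_type.

Definition lquot_pi (x : V) : lquot_type := \pi_(Quotient.quot lspan_zmod) x.

Lemma lquot_piP x y : lquot_pi x = lquot_pi y <-> lspan (x - y).
Proof.
split=> [/eqP|hxy]; first by rewrite -Quotient.idealrBE => /asboolP.
by apply/eqP; rewrite -Quotient.idealrBE; apply/asboolP.
Qed.

Lemma lquot_piD x y : lquot_pi (x + y) = lquot_pi x + lquot_pi y.
Proof. exact: raddfD. Qed.

Definition lquot_repr (x : lquot_type) : V :=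
  repr (x : Quotient.quot lspan_zmod).

Lemma lquot_reprK : cancel lquot_repr lquot_pi.
Proof. exact: (@reprK _ (Quotient.quot lspan_zmod)). Qed.

Definition lquot_scale (a : R) (x : lquot_type) : lquot_type :=
  lquot_pi (a *: lquot_repr x).

Lemma lquot_piZ a x : lquot_scale a (lquot_pi x) = lquot_pi (a *: x).
Proof.
apply/lquot_piP; rewrite -scalerBr -[_ *: _]addr0; apply/asboolP.
have [span0 spanP] := lspan_closed; apply: spanP => //.
by apply/asboolP/lquot_piP; exact: lquot_reprK.
Qed.

Lemma lquot_scaleA a b x :
  lquot_scale a (lquot_scale b x) = lquot_scale (a * b) x.
Proof. by rewrite -(lquot_reprK x) !lquot_piZ scalerA. Qed.
Lemma lquot_scale1 : left_id 1 lquot_scale.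
Proof. by move=> x; rewrite -(lquot_reprK x) lquot_piZ scale1r. Qed.
Lemma lquot_scaleDr : right_distributive lquot_scale +%R.
Proof.
move=> a x y; rewrite -(lquot_reprK x) -(lquot_reprK y).
by rewrite -lquot_piD !lquot_piZ -lquot_piD scalerDr.
Qed.
Lemma lquot_scaleDl x : {morph lquot_scale^~ x : a b / a + b}.
Proof.
by move=> a b; rewrite -(lquot_reprK x) !lquot_piZ -lquot_piD scalerDl.
Qed.

HB.instance Definition _ := GRing.Zmodule_isLmodule.Build R lquot_type
  lquot_scaleA lquot_scale1 lquot_scaleDr lquot_scaleDl.

Lemma lquot_pi_linear : linear lquot_pi.
Proof. by move=> a x y; rewrite lquot_piD -lquot_piZ. Qed.

HB.instance Definition _ :=
  GRing.isLinear.Build R V lquot_type _ lquot_pi lquot_pi_linear.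

Section Lift.
Variables (W : lmodType R) (g : {linear V -> W}).
Hypothesis gB : forall b, B b -> g b = 0.

Definition lquot_lift (x : lquot_type) : W := g (lquot_repr x).

Lemma lquot_liftE x : lquot_lift (lquot_pi x) = g x.
Proof.
apply/eqP; rewrite -subr_eq0 -linearB; apply/eqP.
have /lquot_piP[s sB ->] := lquot_reprK (lquot_pi x).
rewrite linear_sum big_seq big1 // => t /sB tB.
by rewrite linearZ /= gB ?scaler0.
Qed.

Lemma lquot_lift_linear : linear lquot_lift.
Proof.
move=> a x y; rewrite -(lquot_reprK x) -(lquot_reprK y).
by rewrite -linearP !lquot_liftE linearP.
Qed.
End Lift.
End Span.

(* The quotient of V by the submodule spanned by B. *)
Definition lquot (V : lmodType R) (B : V -> Prop) : lmodType R := lquot_type B.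

Definition fin_gen (U : lmodType R) : Prop :=
  exists s : seq U, forall x, lspan (fun y => y \in s) x.

Definition injective_module (E : lmodType R) : Prop :=
  forall (N N' : lmodType R) (j : {linear N -> N'}) (f : {linear N -> E}),
    injective j -> exists g : {linear N' -> E}, forall x, g (j x) = f x.

Definition essential (N E : lmodType R) (i : {linear N -> E}) : Prop :=
  injective i /\
  forall S : submodClosed E, (exists2 x, x \in S & x != 0) ->
    exists2 y, i y \in S & i y != 0.

Definition is_injective_hull (N E : lmodType R) (i : {linear N -> E}) : Prop :=
  injective_module E /\ essential i.

Definition is_direct_limit (X : nat -> lmodType R)
    (t : forall e, {linear X e -> X e.+1})
    (M : lmodType R) (iota : forall e, {linear X e -> M}) : Prop :=
  (forall e x, iota e.+1 (t e x) = iota e x) /\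
  forall (N : lmodType R) (g : forall e, {linear X e -> N}),
    (forall e x, g e.+1 (t e x) = g e x) ->
    exists h : {linear M -> N}, (forall e x, h (iota e x) = g e x) /\
      forall h' : {linear M -> N}, (forall e x, h' (iota e x) = g e x) ->
        h' =1 h.

End Modules.

Section RestrictionOfScalars.
Variables (A B : comNzRingType) (phi : {rmorphism A -> B}) (M : lmodType B).

Definition restrict_type : Type := M.
HB.instance Definition _ := GRing.Zmodule.on restrict_type.

Definition restrict_scale (a : A) (x : restrict_type) : restrict_type :=
  phi a *: (x : M).

Lemma restrict_scaleA a b x :
  restrict_scale a (restrict_scale b x) = restrict_scale (a * b) x.
Proof. by rewrite /restrict_scale scalerA rmorphM. Qed.
Lemma restrict_scale1 : left_id 1 restrict_scale.
Proof. by move=> x; rewrite /restrict_scale rmorph1 scale1r. Qed.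
Lemma restrict_scaleDr : right_distributive restrict_scale +%R.
Proof. by move=> a x y; exact: scalerDr. Qed.
Lemma restrict_scaleDl x : {morph restrict_scale^~ x : a b / a + b}.
Proof. by move=> a b; rewrite /restrict_scale rmorphD scalerDl. Qed.

HB.instance Definition _ := GRing.Zmodule_isLmodule.Build A restrict_type
  restrict_scaleA restrict_scale1 restrict_scaleDr restrict_scaleDl.

Definition restrict : lmodType A := restrict_type.
End RestrictionOfScalars.

Section Tensor.
Variables (R : comNzRingType) (B : lmodType R) (ract : B -> R -> B).

Section Obj.
Variable M : lmodType R.

Definition tens_free : lmodType R := {freeg (B * M) / R}.
Definition tens_gen (b : B) (m : M) : tens_free := [freeg [:: (1, (b, m))]].

(* TensLeft makes r (x) m left-linear in r, so that the quotient is taken in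
   left R-modules rather than in abelian groups. *)
Inductive tens_rel : tens_free -> Prop :=
| TensAddl b b' m :
    tens_rel (tens_gen (b + b') m - (tens_gen b m + tens_gen b' m))
| TensAddr b m m' :
    tens_rel (tens_gen b (m + m') - (tens_gen b m + tens_gen b m'))
| TensBalanced b a m : tens_rel (tens_gen (ract b a) m - tens_gen b (a *: m))
| TensLeft a b m : tens_rel (tens_gen (a *: b) m - a *: tens_gen b m).

(* B (x)_R M, for the bimodule B with right action ract; R acts through the
   left action on B. *)
Definition tensor : lmodType R := lquot tens_rel.
Definition tens (b : B) (m : M) : tensor := lquot_pi tens_rel (tens_gen b m).

Let pi_eq x y : tens_rel (x - y) -> lquot_pi tens_rel x = lquot_pi tens_rel y.
Proof. by move=> xy; apply/lquot_piP/lspan_gen. Qed.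

Lemma tensDl b b' m : tens (b + b') m = tens b m + tens b' m.
Proof. by rewrite -lquot_piD; apply/pi_eq/TensAddl. Qed.
Lemma tensDr b m m' : tens b (m + m') = tens b m + tens b m'.
Proof. by rewrite -lquot_piD; apply/pi_eq/TensAddr. Qed.
Lemma tens_balanced b a m : tens (ract b a) m = tens b (a *: m).
Proof. exact/pi_eq/TensBalanced. Qed.
Lemma tensZl a b m : tens (a *: b) m = a *: tens b m.
Proof. by rewrite -linearZ; apply/pi_eq/TensLeft. Qed.
End Obj.

Section Map.
Variables (M N : lmodType R) (f : {linear M -> N}).

Definition tens_free_map : tens_free M -> tensor N :=
  fglift (fun t : B * M => tens t.1 (f t.2)).

Lemma tens_free_mapB : {morph tens_free_map : x y / x - y}.
Proof. exact: lift_is_additive. Qed.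

Lemma tens_free_map_gen b m : tens_free_map (tens_gen b m) = tens b (f m).
Proof. by rewrite /tens_free_map liftU scale1r. Qed.

Lemma tens_free_mapZ : scalable tens_free_map.
Proof.
have map0 : tens_free_map 0 = 0 by rewrite -(subrr 0) tens_free_mapB subrr.
have mapN y : tens_free_map (- y) = - tens_free_map y.
  by rewrite -[- y]sub0r tens_free_mapB map0 sub0r.
have mapD : {morph tens_free_map : x y / x + y}.
  by move=> x y; rewrite -[y in LHS]opprK tens_free_mapB mapN opprK.
have map_sum (s : seq (B * M)) (F : B * M -> tens_free M) :
    tens_free_map (\sum_(t <- s) F t) = \sum_(t <- s) tens_free_map (F t).
  exact: (big_morph _ mapD map0).
move=> a x; rewrite -[x in LHS]freeg_sumE -[x in RHS]freeg_sumE.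
rewrite scaler_sumr !map_sum scaler_sumr; apply: eq_bigr => t _.
have -> : a *: [freeg [:: (coeff t x, t)]] = [freeg [:: (a * coeff t x, t)]].
  by apply/eqP/freeg_eqP => u; rewrite coeffZ !coeffU mulrA.
by rewrite /tens_free_map !liftU scalerA.
Qed.


HB.instance Definition _ :=
  GRing.isZmodMorphism.Build (tens_free M) (tensor N) tens_free_map
    tens_free_mapB.
HB.instance Definition _ :=
  GRing.isScalable.Build R (tens_free M) (tensor N) _ tens_free_map
    tens_free_mapZ.

Lemma tens_free_map_rel x : tens_rel x -> tens_free_map x = 0.
Proof.
case=> [b b' m|b m m'|b a m|a b m]; rewrite tens_free_mapB.
- by rewrite raddfD /= !tens_free_map_gen tensDl subrr.
- by rewrite raddfD /= !tens_free_map_gen linearD tensDr subrr.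
- by rewrite !tens_free_map_gen linearZ /= tens_balanced subrr.
- by rewrite tens_free_mapZ !tens_free_map_gen tensZl subrr.
Qed.

Definition tens_map_fun : tensor M -> tensor N :=
  lquot_lift (B := @tens_rel M) tens_free_map.

Lemma tens_map_linear : linear tens_map_fun.
Proof. exact: (lquot_lift_linear tens_free_map_rel). Qed.

HB.instance Definition _ :=
  GRing.isLinear.Build R (tensor M) (tensor N) _ tens_map_fun tens_map_linear.

Definition tens_map : {linear tensor M -> tensor N} := tens_map_fun.

Lemma tens_mapE b m : tens_map (tens b m) = tens b (f m).
Proof.
exact: etrans (lquot_liftE tens_free_map_rel _) (tens_free_map_gen b m).
Qed.
End Map.
End Tensor.

Section Frobenius.
Variables (R : comNzRingType) (p : nat).

(* R^1 is the bimodule R^o with this right action; it is a right action when R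
   has characteristic p. *)
Definition frob_ract (r : R^o) (a : R) : R^o := r * a ^+ p.

Definition frob (M : lmodType R) : lmodType R := tensor frob_ract M.

Definition frob_tens (M : lmodType R) (r : R) (m : M) : frob M :=
  tens frob_ract r m.

Definition frob_map (M N : lmodType R) (f : {linear M -> N}) :
  {linear frob M -> frob N} := tens_map frob_ract f.

Fixpoint frob_iter (e : nat) (M : lmodType R) : lmodType R :=
  if e is e'.+1 then frob (frob_iter e' M) else M.

Fixpoint frob_iter_map (U : lmodType R) (beta : {linear U -> frob U}) (e : nat) :
    {linear frob_iter e U -> frob_iter e.+1 U} :=
  if e is e'.+1 then frob_map (frob_iter_map beta e') else beta.

Record fmodule := FModule {
  fmod_carrier :> lmodType R;
  fmod_struct : {linear fmod_carrier -> frob fmod_carrier};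
  fmod_struct_bij : bijective fmod_struct
}.

(* iota exhibits M as the direct limit of U -> F(U) -> F^2(U) -> ..., and the
   structure isomorphism of M is the shift: on the image of F^(e+1)(U) in M it
   is the canonical map F(iota_e) : F(F^e(U)) -> F(M). *)
Definition generated_by (M : fmodule) (U : lmodType R)
    (beta : {linear U -> frob U}) (iota : forall e, {linear frob_iter e U -> M}) :
    Prop :=
  is_direct_limit (frob_iter_map beta) iota /\
  forall e (x : frob_iter e.+1 U),
    fmod_struct M (iota e.+1 x) = frob_map (iota e) x.

End Frobenius.

Section Graded.
Variables (A : comNzRingType) (n : nat).
Local Notation R := {mpoly A[n]}.
Local Notation Zn := 'rV[int]_n.

Definition mnm_degree (m : 'X_{1..n}) : Zn := \row_i (m i)%:Z.

(* The grading of R is extended by 0 from N^n to Z^n. *)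
Definition homogeneous (u : Zn) (r : R) : Prop :=
  forall m, m \in msupp r -> mnm_degree m = u.

Record grading (M : lmodType R) := Grading {
  gcomp :> Zn -> M -> Prop;
  gcomp0 : forall u, gcomp u 0;
  gcompB : forall u x y, gcomp u x -> gcomp u y -> gcomp u (x - y);
  gcompZ : forall u v r x,
    homogeneous u r -> gcomp v x -> gcomp (u + v) (r *: x);
  gcomp_span : forall x, exists (s : seq Zn) (c : Zn -> M),
    (forall u, gcomp u (c u)) /\ x = \sum_(u <- s) c u;
  gcomp_direct : forall (s : seq Zn) (c : Zn -> M), uniq s ->
    (forall u, gcomp u (c u)) -> \sum_(u <- s) c u = 0 ->
    forall u, u \in s -> c u = 0
}.

Section Component.
Variables (M : lmodType R) (G : grading M) (u : Zn).
Local Notation MA := (restrict (@mpolyC n A) M).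

Definition gcomp_pred : MA -> bool := fun x => `[< G u x >].

Lemma homogeneousC a : homogeneous 0 (a%:MP_[n] : R).
Proof.
move=> m; rewrite msuppC; case: ifP => // _; rewrite inE => /eqP ->.
by apply/rowP => i; rewrite !mxE mnm0E.
Qed.

Lemma gcomp_closed : submod_closed gcomp_pred.
Proof.
split; first exact/asboolP/gcomp0.
move=> a x y /asboolP Gx /asboolP Gy; apply/asboolP.
rewrite -[y]opprK; apply: gcompB; last first.
  by rewrite -[- y]sub0r; apply: gcompB => //; exact: gcomp0.
by rewrite -[u]add0r; apply: gcompZ => //; exact: homogeneousC.
Qed.

HB.instance Definition _ :=
  GRing.isSubmodClosed.Build A MA gcomp_pred gcomp_closed.

Definition component_type : Type := {x : MA | gcomp_pred x}.
HB.instance Definition _ := SubChoice.on component_type.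
HB.instance Definition _ := [SubChoice_isSubLmodule of component_type by <:].

(* M_u, as a module over A = R_0. *)
Definition component : lmodType A := component_type.
End Component.

Variable p : nat.

(* The degree-u part of F(M), for deg (r (x) m) = deg r + p deg m. *)
Definition frob_gcomp (M : lmodType R) (G : Zn -> M -> Prop) (u : Zn)
    (x : frob p M) : Prop :=
  exists2 s : seq (R * M),
    forall t, t \in s -> exists v w,
      [/\ homogeneous v t.1, G w t.2 & v + w *+ p = u]
    & x = \sum_(t <- s) frob_tens p t.1 t.2.

Fixpoint frob_iter_gcomp (e : nat) (U : lmodType R) (G : Zn -> U -> Prop) :
    Zn -> frob_iter p e U -> Prop :=
  if e is e'.+1 then frob_gcomp (@frob_iter_gcomp e' U G) else G.

Definition graded_F_finite (M : fmodule R p) (G : grading M) : Prop :=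
  exists (U : lmodType R) (GU : grading U) (beta : {linear U -> frob p U})
      (iota : forall e, {linear frob_iter p e U -> M}),
    [/\ fin_gen U,
        forall u x, GU u x -> frob_gcomp GU u (beta x),
        generated_by beta iota
      & forall u m, G u m <->
          exists e (x : frob_iter p e U),
            frob_iter_gcomp GU u x /\ m = iota e x].

End Graded.

Section DVRModules.
Variable K : fieldType.
Local Notation A := (powser K).

(* A / YA *)
Definition residue_module : lmodType A :=
  lquot (V := A^o) (fun y => y = psX K).

(* Q(A) as an A-module *)
Definition fraction_module : lmodType A :=
  restrict (@FracField.tofrac A) ({fraction A}^o).
End DVRModules.

(* Main.v *)
Require Import Defs.
From HB Require Import structures.
From mathcomp Require Import all_boot all_algebra.
From mathcomp Require Import generic_quotient boolp.
From mathcomp Require Import freeg mpoly.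
From mathcomp Require Import fintype.

Set Implicit Arguments.
Unset Strict Implicit.
Unset Printing Implicit Defensive.

Import GRing.Theory.
Local Open Scope ring_scope.

(** Write [A] for the power series ring, a complete discrete valuation ring
    with uniformizer [Y], and [R] for [A[X_1, .., X_n]].

    The grading by [Z^n] is so fine that a homogeneous generator of [U]
    contributes at most one monomial multiple to each component.  Hence, if [U]
    has [r] homogeneous generators, each [U_v] is an [A]-module with [r]
    generators, a direct sum of modules [A / d_j] (cyclic_decomposition,
    graded_cyclic_component).  Every monomial is in one way a product
    of [X^al], with exponents below [p], and a p-th power of a monomial, which
    moves across the tensor sign.  So [F(U)_u] is the Frobenius base change of
    [U_v] for [v = floor (u / p)], the direct sum of the modules [A / d_j^p]
    (frob_cyclic_component).  Therefore
    [F^e(U)_u] is a direct sum of [r] modules [A / d_j^(p^e)], with [r]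
    independent of [e].

    Two properties pass to the limit [M_u].

    - Any [r + 1] elements satisfy a linear relation with a unit coefficient
      (component_relations), because they come from one module with [r]
      generators.
    - An element killed by [Y] is divisible by every power of [Y]
      (component_socle_divisible).  It comes from elements of [F^e(U)_u] for
      all large [e] that are themselves killed by [Y], and in [A / d^(p^e)]
      these are multiples of [Y^(p^e - 1)].

    These two properties alone give the decomposition
    (divisible_torsion_decomposition).  The torsion submodule is divisible with
    a socle of finite dimension [a], and a map to [E^a] extending a basis of
    the socle splits it off (split_torsion).  The kernel of that map is
    torsion-free of finite rank.  There, lifts of a basis modulo [Y] span a free
    module which, by completeness, is a complement of the divisible part
    (free_complement), and the divisible part is a finite-dimensional vector
    space over the fraction field (divisible_rank). *)

(** * Power series as a discrete valuation ring *)

Definition divides (R : comNzRingType) (a b : R) := exists q, b = q * a.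

Section Valuation.
Variable K : fieldType.
Local Notation A := (powser K).
Local Notation Y := (psX K).
Implicit Types a b : A.

Lemma coefsD a b k : coefs (a + b) k = coefs a k + coefs b k.
Proof. by []. Qed.

Lemma coefsM a b k :
  coefs (a * b) k = \sum_(i < k.+1) coefs a i * coefs b (k - i).
Proof. by []. Qed.

Lemma coefs0M a b : coefs (a * b) 0 = coefs a 0 * coefs b 0.
Proof. by rewrite coefsM big_ord1. Qed.

Lemma coefsXM a k : coefs (Y * a) k = if k is k'.+1 then coefs a k' else 0.
Proof.
rewrite coefsM; case: k => [|k]; first by rewrite big_ord1 mul0r.
rewrite big_ord_recl mul0r add0r big_ord_recl /= mul1r.
rewrite big1 ?addr0 ?subSS ?subn0 // => i _.
by rewrite mul0r.
Qed.

Lemma psX_neq0 : Y != 0.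
Proof.
by apply/eqP => /(congr1 (fun q => coefs q 1)) /eqP; rewrite oner_eq0.
Qed.

Lemma unit_psE a : (a \is a GRing.unit) = (coefs a 0 != 0).
Proof. by []. Qed.

Lemma nonunit_psX a : coefs a 0 = 0 -> exists b, a = Y * b.
Proof.
move=> a0; exists (PowSer (fun k => coefs a k.+1)); apply: powserP => k.
by rewrite coefsXM; case: k.
Qed.

Lemma divides_trans b a c : divides a b -> divides b c -> divides a c.
Proof. by move=> [q ->] [r ->]; exists (r * q); rewrite mulrA. Qed.

Lemma dividesXP a : divides Y a <-> coefs a 0 = 0.
Proof.
split=> [[q ->]|/nonunit_psX[b ->]]; last by exists b; rewrite mulrC.
by rewrite coefs0M mulr0.
Qed.

Lemma ps_factor a : a != 0 -> exists k b, b \is a GRing.unit /\ a = Y ^+ k * b.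
Proof.
move=> a0.
have /ex_minnP[k ak mink] : exists k, coefs a k != 0.
  by apply: contra_neqP a0 => nk; apply: powserP => k; apply/eqP;
     apply: contra_notT nk => ?; exists k.
exists k; elim: k a ak mink {a0} => [|k IHk] a ak mink.
  by exists a; rewrite mul1r.
have [|b aE] := @nonunit_psX a; first by apply/eqP; apply: contraT => /mink.
have [|j bj|c [uc bE]] := IHk b; first by move: ak; rewrite aE coefsXM.
  by rewrite -ltnS mink // aE coefsXM.
by exists c; rewrite aE bE exprS mulrA.
Qed.

Lemma divides_total a b : divides a b \/ divides b a.
Proof.
have [->|a0] := eqVneq a 0; first by right; exists 0; rewrite mul0r.
have [->|b0] := eqVneq b 0; first by left; exists 0; rewrite mul0r.
have [k [a' [ua ->]]] := ps_factor a0; have [l [b' [ub ->]]] := ps_factor b0.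
case: (leqP k l) => [/subnK <-|/ltnW /subnK <-]; [left|right].
  exists (Y ^+ (l - k) * b' / a'); rewrite exprD.
  by rewrite (mulrC (Y ^+ k) a') mulrA divrK // mulrAC.
exists (Y ^+ (k - l) * a' / b'); rewrite exprD.
by rewrite (mulrC (Y ^+ l) b') mulrA divrK // mulrAC.
Qed.

Lemma divides_min (m : nat) (x : 'I_m.+1 -> A) :
  exists j, forall i, divides (x j) (x i).
Proof.
elim: m x => [|m IHm] x.
  by exists ord0 => i; exists 1; rewrite (ord1 i) mul1r.
have [j hj] := IHm (fun i => x (lift ord0 i)).
have [x0j|xj0] := divides_total (x ord0) (x (lift ord0 j)).
  exists ord0 => i; case: (unliftP ord0 i) => [k ->|->].
    exact: divides_trans x0j (hj k).
  by exists 1; rewrite mul1r.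
exists (lift ord0 j) => i; case: (unliftP ord0 i) => [k ->|->] //.
Qed.

Lemma pchar_powser p : p \in [pchar K] -> p \in [pchar A].
Proof.
rewrite !inE => /andP[-> /eqP p0] /=; apply/eqP/powserP => k.
have natE m : coefs (m%:R : A) k = m%:R * coefs (1 : A) k.
  elim: m => [|m IHm]; first by rewrite mul0r.
  by rewrite -!natr1 coefsD IHm mulrDl mul1r.
by rewrite natE p0 mul0r.
Qed.

End Valuation.

(** * Linear maps given by their graphs *)

Section LinearGraphs.
Variable R : comNzRingType.

(** Coordinates with respect to generators that are subject to relations are
    only determined up to those relations; a graph avoids choosing them
    linearly. *)
Lemma linear_of_graph (V W : lmodType R) (P : V -> W -> Prop) :
  (forall x, exists y, P x y) ->
  (forall a x y x' y', P x y -> P x' y' -> P (a *: x + x') (a *: y + y')) ->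
  (forall y, P 0 y -> y = 0) ->
  exists f : {linear V -> W}, forall x y, P x y <-> y = f x.
Proof.
move=> Pex Plin P0; have [f Pf] := choice Pex.
have Puniq x y : P x y -> y = f x.
  move=> Pxy; apply/eqP; rewrite -subr_eq0; apply/eqP/P0.
  have := Plin (-1) _ _ _ _ (Pf x) Pxy.
  by rewrite !scaleN1r addNr addrC.
have flin : linear f.
  by move=> a x y; apply/esym/Puniq/Plin; apply: Pf.
pose F := GRing.isLinear.Build R V W _ f flin.
pose g : {linear V -> W} := HB.pack f F.
by exists g => x y; split=> [/Puniq|->] //; apply: Pf.
Qed.

Lemma lmod_iso_of_graph (V W : lmodType R) (P : V -> W -> Prop) :
  (forall x, exists y, P x y) -> (forall y, exists x, P x y) ->
  (forall a x y x' y', P x y -> P x' y' -> P (a *: x + x') (a *: y + y')) ->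
  (forall y, P 0 y -> y = 0) -> (forall x, P x 0 -> x = 0) ->
  lmod_iso V W.
Proof.
move=> Pex Psurj Plin P0 Pinj; have [f fP] := linear_of_graph Pex Plin P0.
exists f; have [g gP] := choice Psurj.
have gK : cancel g f by move=> y; apply/esym/fP.
exists g => // x; apply/eqP; rewrite -subr_eq0; apply/eqP/Pinj/fP.
by rewrite linearB /= gK subrr.
Qed.

End LinearGraphs.

(** * Relations with a unit coefficient *)

Section Span.
Variables (R : pzRingType) (V : lmodType R).

Definition span_of (r : nat) (w : 'I_r -> V) (x : V) : Prop :=
  exists a : 'I_r -> R, x = \sum_j a j *: w j.

Lemma span_of_gen r (w : 'I_r -> V) j : span_of w (w j).
Proof.
exists (fun l => (l == j)%:R).
rewrite (bigD1 j) //= eqxx scale1r big1 ?addr0 //.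
by move=> l /negbTE ->; rewrite scale0r.
Qed.

Lemma span_ofP r (w : 'I_r -> V) a x y :
  span_of w x -> span_of w y -> span_of w (a *: x + y).
Proof.
move=> [b ->] [c ->]; exists (fun j => a * b j + c j).
rewrite scaler_sumr -big_split; apply: eq_bigr => j _ /=.
by rewrite scalerDl scalerA.
Qed.

Lemma span_of0 r (w : 'I_r -> V) : span_of w 0.
Proof. by exists (fun=> 0); rewrite big1 // => j _; rewrite scale0r. Qed.

Lemma span_ofZ r (w : 'I_r -> V) a x : span_of w x -> span_of w (a *: x).
Proof.
by move=> wx; rewrite -[_ *: _]addr0; apply: span_ofP => //; apply: span_of0.
Qed.

Lemma span_ofD r (w : 'I_r -> V) x y :
  span_of w x -> span_of w y -> span_of w (x + y).
Proof. by rewrite -[x in span_of _ (x + y)]scale1r; apply: span_ofP. Qed.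

Lemma span_of_sum r (w : 'I_r -> V) (T : Type) (s : seq T) (P : pred T) F :
  (forall t, P t -> span_of w (F t)) -> span_of w (\sum_(t <- s | P t) F t).
Proof.
by move=> wF; apply: big_ind => //; [exact: span_of0|exact: span_ofD].
Qed.

Lemma span_of_trans r s (w : 'I_r -> V) (v : 'I_s -> V) x :
  (forall j, span_of v (w j)) -> span_of w x -> span_of v x.
Proof. by move=> vw [a ->]; apply: span_of_sum => j _; apply: span_ofZ. Qed.

End Span.

Section UnitRelations.
Variable K : fieldType.
Local Notation A := (powser K).
Local Notation Y := (psX K).

(** A substitute for having at most [r] generators which, unlike that property,
    is inherited by all submodules and bounds at the same time the rank, the
    dimension of the socle and the dimension modulo [Y]. *)
Definition unit_relations (r : nat) (N : lmodType A) (S : N -> Prop) : Prop :=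
  forall x : 'I_r.+1 -> N, (forall i, S (x i)) ->
    exists a : 'I_r.+1 -> A,
      \sum_i a i *: x i = 0 /\ exists i, coefs (a i) 0 != 0.

(** Gaussian elimination over a valuation ring: the pivot divides its whole
    column, so [w 0] can be eliminated over [A], and the relation found among
    the reduced elements keeps its unit coefficient. *)
Lemma unit_relation_span (r : nat) (V : lmodType A) (w : 'I_r -> V) :
  unit_relations r (span_of w).
Proof.
elim: r w => [|r IHr] w x /choice[C xE].
  exists (fun=> 1); split; last by exists ord0; rewrite oner_neq0.
  by rewrite big1 // => i _; rewrite scale1r xE big_ord0.
have [j0 /choice[q Cq]] := divides_min (fun i => C i ord0).
pose x' k := x (lift j0 k) - q (lift j0 k) *: x j0.
have [k|a [a0 [k ak]]] := IHr (fun i => w (lift ord0 i)) x'.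
  exists (fun i => C (lift j0 k) (lift ord0 i)
                   - q (lift j0 k) * C j0 (lift ord0 i)).
  rewrite /x' !xE !big_ord_recl scalerDr opprD addrACA.
  rewrite scalerA Cq subrr add0r scaler_sumr -sumrB.
  by apply: eq_bigr => i _; rewrite scalerBl scalerA.
exists (fun i => if unlift j0 i is Some k then a k
                 else - \sum_k a k * q (lift j0 k)); split; last first.
  by exists (lift j0 k); rewrite liftK.
rewrite (bigD1_ord j0) //= unlift_none.
rewrite (eq_bigr (fun k => a k *: x' k + (a k * q (lift j0 k)) *: x j0)).
  by rewrite big_split /= a0 add0r scaleNr -scaler_suml addNr.
by move=> l _; rewrite liftK /x' scalerBr scalerA subrK.
Qed.

(** The elements [x] are a maximal family of [S] that is independent modulo [Z]
    up to coefficients in [I].  It is used for a basis of the socle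
    ([I = Y A], [Z = 0]), for a basis modulo [Y] ([I = Y A], [Z = Y S]) and for
    a basis over the fraction field ([I = 0], [Z = 0]). *)
Lemma maximal_independent (r : nat) (N : lmodType A) (S Z : N -> Prop)
    (I : A -> Prop) :
  unit_relations r S -> Z 0 -> (forall x y, Z x -> Z y -> Z (x - y)) ->
  (forall a, I a -> coefs a 0 = 0) ->
  (forall a y, I a -> S y -> Z (a *: y)) ->
  exists (c : nat) (x : 'I_c -> N),
    [/\ forall i, S (x i),
        forall a : 'I_c -> A, Z (\sum_i a i *: x i) -> forall i, I (a i)
      & forall y, S y -> exists a (b : 'I_c -> A),
          ~ I a /\ Z (a *: y + \sum_i b i *: x i)].
Proof.
move=> relS Z0 ZB I0 IZ.
pose Q c := exists x : 'I_c -> N, (forall i, S (x i)) /\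
  forall a : 'I_c -> A, Z (\sum_i a i *: x i) -> forall i, I (a i).
have [c [[x [Sx Ix]] nQ]] : exists c, Q c /\ ~ Q c.+1.
  apply: contrapT => nex.
  have Qall c : Q c.
    elim: c => [|c Qc]; first by exists (fun=> 0); split=> [[]|? ? []].
    by apply: contrapT => nQ; apply: nex; exists c.
  have [x [Sx Ix]] := Qall r.+1; have [a [a0 [i]]] := relS x Sx.
  by rewrite I0 ?eqxx //; apply: Ix; rewrite a0.
exists c, x; split=> // y Sy; apply: contrapT => nex; apply: nQ.
(* Otherwise the family enlarged by [y] would still be independent. *)
exists (fun i => if unlift ord0 i is Some k then x k else y); split=> [i|a].
  by case: unliftP.
rewrite big_ord_recl unlift_none.
under eq_bigr do rewrite liftK.
move=> Za; have Ia0 : I (a ord0).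
  apply: contrapT => nI; apply: nex.
  by exists (a ord0), (fun i => a (lift ord0 i)).
have Zs : Z (\sum_(i < c) a (lift ord0 i) *: x i).
  rewrite -[X in Z X](addKr (a ord0 *: y)) addrC.
  by apply: ZB => //; apply: IZ.
by move=> i; case: (unliftP ord0 i) => [k ->|-> //]; apply: Ix Zs k.
Qed.

End UnitRelations.

(** * Cyclic modules and the hull of the residue field *)

Section CyclicModule.
Variable R : comNzRingType.
Implicit Types a b d : R.

Lemma lspan_singleP (V : lmodType R) (b x : V) :
  lspan (fun y => y = b) x <-> exists a, x = a *: b.
Proof.
split=> [[s sb ->]|[a ->]]; last first.
  exists [:: (a, b)]; last by rewrite big_seq1.
  by move=> t; rewrite inE => /eqP ->.
exists (\sum_(t <- s) t.1); rewrite scaler_suml.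
by apply: eq_big_seq => t /sb ->.
Qed.

Definition cyclic_mod d : lmodType R := lquot (V := R^o) (fun y => y = d).
Definition cyclic_class d a : cyclic_mod d :=
  lquot_pi (fun y : R^o => y = d) (a : R^o).

Lemma cyclic_class0 d : cyclic_class d 0 = 0.
Proof. exact: (linear0 (lquot_pi (fun y : R^o => y = d))). Qed.

Lemma cyclic_classD d a b :
  cyclic_class d (a + b) = cyclic_class d a + cyclic_class d b.
Proof. exact: lquot_piD. Qed.

Lemma cyclic_classZ d a b : cyclic_class d (a * b) = a *: cyclic_class d b.
Proof. exact: (linearZ_LR (lquot_pi (fun y : R^o => y = d))). Qed.

Lemma cyclic_class_eq d a b :
  cyclic_class d a = cyclic_class d b <-> divides d (a - b).
Proof.
split=> [/lquot_piP/lspan_singleP[q]|[q abE]]; first by exists q.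
by apply/lquot_piP/lspan_singleP; exists q.
Qed.

Lemma cyclic_class_eq0 d a : cyclic_class d a = 0 <-> divides d a.
Proof. by rewrite -(cyclic_class0 d) cyclic_class_eq subr0. Qed.

Definition cyclic_repr d (x : cyclic_mod d) : R :=
  lquot_repr (V := R^o) (B := fun y => y = d) x.

Lemma cyclic_reprK d (x : cyclic_mod d) : cyclic_class d (cyclic_repr x) = x.
Proof. exact: lquot_reprK. Qed.

Lemma cyclic_class_surj d (x : cyclic_mod d) : exists a, x = cyclic_class d a.
Proof. by exists (cyclic_repr x); rewrite cyclic_reprK. Qed.

End CyclicModule.

Section ResidueHull.
Variable K : fieldType.
Local Notation A := (powser K).
Local Notation Y := (psX K).
Variables (E : lmodType A) (i : {linear residue_module K -> E}).
Hypothesis E_hull : is_injective_hull i.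

Lemma residue_eq0 a : cyclic_class Y a = 0 <-> coefs a 0 = 0.
Proof. by rewrite cyclic_class_eq0 dividesXP. Qed.

Definition hull_gen : E := i (cyclic_class Y 1).
Local Notation e0 := hull_gen.

Lemma hull_genZ a : a *: e0 = i (cyclic_class Y a).
Proof. by rewrite -linearZ_LR -cyclic_classZ mulr1. Qed.

Lemma hull_genZ_eq0 a : a *: e0 = 0 <-> coefs a 0 = 0.
Proof.
rewrite hull_genZ -residue_eq0; split=> [ia0|->]; last exact: linear0.
by case: E_hull => _ [inji _]; apply: inji; rewrite ia0 linear0.
Qed.

Lemma hull_gen_neq0 : e0 <> 0.
Proof.
move=> e00; have /hull_genZ_eq0 : (1 : A) *: e0 = 0 by rewrite e00 scaler0.
by move/eqP; rewrite oner_eq0.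
Qed.

(** Essentiality, applied to the submodule generated by [e]. *)
Lemma hull_gen_mult (e : E) : e <> 0 -> exists a, a *: e = e0.
Proof.
move=> e_neq0; case: E_hull => _ [_ ess].
have [|y] := ess (GRing.SubmodClosed.clone A E (lspan_pred (fun y => y = e)) _).
  exists e; last exact/eqP.
  by apply/asboolP; apply: lspan_gen.
move=> /asboolP/lspan_singleP[a]; have [b ->] := cyclic_class_surj y.
rewrite -hull_genZ => abe /eqP bn0.
have ub : b \is a GRing.unit.
  by rewrite unit_psE; apply/eqP => /hull_genZ_eq0.
by exists (b^-1 * a); rewrite -scalerA -abe scalerA mulVr // scale1r.
Qed.

Lemma hull_torsion (e : E) : exists k, Y ^+ k *: e = 0.
Proof.
have [->|/eqP en0] := eqVneq e 0; first by exists 0%N; rewrite scaler0.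
have [a ae] := hull_gen_mult en0.
have [|k [u [uu aE]]] := @ps_factor K a.
  by apply/eqP => a0; apply: hull_gen_neq0; rewrite -ae a0 scale0r.
exists k.+1; have -> : Y ^+ k.+1 = u^-1 * (Y * a).
  by rewrite aE exprS [RHS]mulrC -!mulrA mulrV ?mulr1.
by rewrite -!scalerA ae (proj2 (hull_genZ_eq0 Y)) ?scaler0.
Qed.

Lemma hull_socle (e : E) : Y *: e = 0 -> exists a, e = a *: e0.
Proof.
have [->|/eqP en0 Ye] := eqVneq e 0; first by exists 0; rewrite scale0r.
have [a ae] := hull_gen_mult en0.
have ua : a \is a GRing.unit.
  rewrite unit_psE; apply/eqP => /nonunit_psX[b aE]; apply: hull_gen_neq0.
  by rewrite -ae aE mulrC -scalerA Ye scaler0.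
by exists a^-1; rewrite -ae scalerA mulVr // scale1r.
Qed.

End ResidueHull.

(** * Splitting off the torsion *)

Section Completeness.
Variable K : fieldType.
Local Notation A := (powser K).
Local Notation Y := (psX K).

(** The series [c m] is the sum of the [Y^j b_(m+j)] over all [j]. *)
Lemma powser_complete (b : nat -> A) :
  exists c : nat -> A, forall m, c m = b m + Y * c m.+1.
Proof.
exists (fun m => PowSer (fun k => \sum_(j < k.+1) coefs (b (m + j)%N) (k - j))).
move=> m; apply: powserP => k; rewrite coefsD coefsXM /= big_ord_recl.
rewrite addn0 subn0; congr (_ + _); case: k => [|k]; first by rewrite big_ord0.
by apply: eq_bigr => j _; rewrite lift0 addnS subSS.
Qed.

End Completeness.

Section SplitTorsion.
Variable K : fieldType.
Local Notation A := (powser K).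
Local Notation Y := (psX K).
Variables (E : lmodType A) (i : {linear residue_module K -> E}).
Hypothesis E_hull : is_injective_hull i.
Local Notation e0 := (hull_gen i).
Variables (N : lmodType A).

Definition torsion (x : N) := exists k, Y ^+ k *: x = 0.

(** The socle with basis [s] is a power of the residue field, so it embeds in
    the same power of its hull, and injectivity extends the embedding. *)
Lemma extend_to_hull (a : nat) (s : 'I_a -> N) :
  (forall j, Y *: s j = 0) ->
  (forall b : 'I_a -> A,
     \sum_j b j *: s j = 0 -> forall j, coefs (b j) 0 = 0) ->
  exists f : {linear N -> {ffun 'I_a -> E}},
    forall b : 'I_a -> A, f (\sum_j b j *: s j) = [ffun j => b j *: e0].
Proof.
move=> Ys inds.
pose P (x : {ffun 'I_a -> residue_module K}) (y : N) :=
  exists b : 'I_a -> A,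
    (forall j, x j = cyclic_class Y (b j)) /\ y = \sum_j b j *: s j.
have [||y [b [b0 ->]]|j jP] := @linear_of_graph _ _ _ P.
- move=> x; have [b bP] := choice (fun j => cyclic_class_surj (x j)).
  by exists (\sum_j b j *: s j), b.
- move=> c x y x' y' [b [xb ->]] [b' [xb' ->]].
  exists (fun j => c * b j + b' j); split=> [j|].
    by rewrite !ffunE xb xb' cyclic_classD cyclic_classZ.
  rewrite scaler_sumr -big_split; apply: eq_bigr => j _ /=.
  by rewrite scalerDl scalerA.
- rewrite big1 // => j _; have := b0 j; rewrite ffunE => /esym/residue_eq0.
  by move=> /nonunit_psX[q ->]; rewrite mulrC -scalerA Ys scaler0.
have jE b : j [ffun l => cyclic_class Y (b l)] = \sum_l b l *: s l.
  by apply/esym/jP; exists b; split=> // l; rewrite ffunE.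
have j_inj : injective j.
  move=> x x' jxx'; apply/eqP; rewrite -subr_eq0; apply/eqP.
  have [b [xb b0]] : P (x - x') 0 by apply/jP; rewrite linearB /= jxx' subrr.
  by apply/ffunP => l; rewrite xb [RHS]ffunE; apply/residue_eq0/inds.
have [g gP] : exists g : 'I_a -> {linear N -> E},
    forall l x, g l (j x) = i (x l).
  suff /choice[g gP] : forall l, exists g : {linear N -> E},
      forall x, g (j x) = i (x l) by exists g.
  move=> l; pose il0 (x : {ffun 'I_a -> residue_module K}) := i (x l).
  have il_lin : linear il0.
    by move=> c x y; rewrite /il0 !ffunE linearP.
  pose F := GRing.isLinear.Build _ _ _ _ _ il_lin.
  pose il : {linear {ffun 'I_a -> residue_module K} -> E} := HB.pack il0 F.
  by case: E_hull => E_inj _; have [g gP] := E_inj _ _ j il j_inj; exists g.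
have f_lin : linear (fun x => [ffun l => g l x] : {ffun 'I_a -> E}).
  by move=> c x y; apply/ffunP => l; rewrite !ffunE linearP.
pose F := GRing.isLinear.Build _ _ _ _ _ f_lin.
pose f : {linear N -> {ffun 'I_a -> E}} :=
  HB.pack (fun x => [ffun l => g l x] : {ffun 'I_a -> E}) F.
exists f => b; rewrite -jE; apply/ffunP => l.
by rewrite [LHS]ffunE gP !ffunE hull_genZ.
Qed.

Hypothesis N_div :
  forall x : N, Y *: x = 0 -> forall k, exists y, x = Y ^+ k *: y.
Variable r : nat.
Hypothesis relN : unit_relations r (fun _ : N => True).

(** If [Y^(k+1) x = 0], then [Y^k x] lies in the socle, so [Y^k x = Y^(k+1) y]
    for some [y], and [x - Y y] is killed by [Y^k]. *)
Lemma torsion_divisible x : torsion x -> exists2 y, torsion y & x = Y *: y.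
Proof.
move=> tx; suff [y xy] : exists y, x = Y *: y.
  exists y => //; case: tx => k xk; exists k.+1.
  by rewrite exprSr -scalerA -xy.
case: tx => k; elim: k x => [|k IHk] x.
  by rewrite scale1r => ->; exists 0; rewrite scaler0.
rewrite exprS -scalerA => /N_div/(_ k.+1)[y xy].
have [|z xyz] := IHk (x - Y *: y).
  by rewrite scalerBr scalerA -exprSr xy subrr.
by exists (z + y); rewrite scalerDr -xyz subrK.
Qed.

(** The map [f] is injective on torsion because it is injective on the socle;
    it is onto because the image of the torsion is divisible and contains the
    socle of [E^a].  So the torsion is isomorphic to [E^a], and [ker f] is a
    complement. *)
Lemma split_torsion : exists (a : nat) (f : {linear N -> {ffun 'I_a -> E}}),
  (forall x, torsion x -> f x = 0 -> x = 0) /\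
  (forall e, exists2 x, torsion x & f x = e).
Proof.
have [|||||a [s [Ys inds maxs]]] := @maximal_independent K r N
    (fun x => Y *: x = 0) (fun x => x = 0) (fun c => coefs c 0 = 0).
- by move=> x _; apply: relN.
- by [].
- by move=> x y -> ->; rewrite subrr.
- by [].
- by move=> c y /nonunit_psX[q ->] Yy; rewrite mulrC -scalerA Yy scaler0.
have [f fP] := extend_to_hull Ys inds; exists a, f.
have f_inj : forall x, torsion x -> f x = 0 -> x = 0.
  move=> x [k]; elim: k x => [|k IHk] x; first by rewrite scale1r.
  rewrite exprSr -scalerA => /IHk xk fx0.
  have Yx : Y *: x = 0 by apply: xk; rewrite linearZ /= fx0 scaler0.
  have [c [b [/eqP]]] := maxs _ Yx; rewrite -unit_psE => uc /eqP.
  rewrite addr_eq0 -sumrN => /eqP cx.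
  suff cx0 : c *: x = 0.
    by rewrite -(scale1r x) -(mulVr uc) -scalerA cx0 scaler0.
  rewrite cx big1 // => j _; suff /nonunit_psX[q ->] : coefs (b j) 0 = 0.
    by rewrite mulrC -scalerA Ys scaler0 oppr0.
  apply/(hull_genZ_eq0 E_hull); have /(congr1 f) := cx.
  rewrite linearZ /= fx0 scaler0.
  rewrite (eq_bigr (fun j => (- b j) *: s j)); last first.
    by move=> ? _; rewrite scaleNr.
  rewrite fP => /ffunP/(_ j); rewrite !ffunE scaleNr => /eqP.
  by rewrite eq_sym oppr_eq0 => /eqP.
split=> // e.
have [k Yke] : exists k, Y ^+ k *: e = 0.
  have [k kP] := choice (fun j => hull_torsion E_hull (e j)).
  exists (\max_j k j); apply/ffunP => j; rewrite !ffunE.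
  by rewrite -(subnK (leq_bigmax j)) exprD -scalerA kP scaler0.
elim: k e Yke => [|k IHk] e.
  rewrite scale1r => ->; exists 0; last exact: linear0.
  by exists 0; rewrite scaler0.
rewrite exprSr -scalerA => /IHk[t /torsion_divisible[t' tt' tE] ft].
have Yet : Y *: (e - f t') = 0.
  by rewrite scalerBr -ft tE linearZ /= subrr.
have [b bE] : exists b : 'I_a -> A, e - f t' = [ffun j => b j *: e0].
  have [j|b bP] := choice (_ : forall j, exists b, (e - f t') j = b *: e0).
    apply: (hull_socle E_hull).
    by have /ffunP/(_ j) := Yet; rewrite [LHS]ffunE [RHS]ffunE.
  by exists b; apply/ffunP => j; rewrite bP ffunE.
exists (t' + \sum_j b j *: s j); last first.
  by rewrite linearD /= fP -bE addrC subrK.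
case: tt' => l t'l; exists l.+1; rewrite scalerDr.
rewrite exprS -scalerA t'l scaler0 add0r scaler_sumr big1 // => j _.
by rewrite scalerA -mulrA mulrC -scalerA Ys scaler0.
Qed.

End SplitTorsion.

(** * Torsion-free modules of finite rank *)

Section TorsionFree.
Variable K : fieldType.
Local Notation A := (powser K).
Local Notation Y := (psX K).
Variables (N : lmodType A) (L : N -> Prop).
Hypotheses (L0 : L 0) (LP : forall a x y, L x -> L y -> L (a *: x + y)).
Hypothesis Ltf : forall x, L x -> Y *: x = 0 -> x = 0.

Let LZ a x : L x -> L (a *: x).
Proof. by move=> Lx; rewrite -[X in L X]addr0; apply: LP. Qed.

Let LB x y : L x -> L y -> L (x - y).
Proof. by move=> Lx Ly; rewrite addrC -scaleN1r; apply: LP. Qed.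

Let Lsum c (a : 'I_c -> A) (x : 'I_c -> N) :
  (forall j, L (x j)) -> L (\sum_j a j *: x j).
Proof.
move=> Lx; apply: (big_ind L) => // [x' y' Lx' Ly'|j _]; last exact: LZ.
by rewrite -[x']scale1r; apply: LP.
Qed.

Lemma torsion_free_scale a x : a != 0 -> L x -> a *: x = 0 -> x = 0.
Proof.
case/ps_factor => k [u [uu ->]] Lx; rewrite mulrC -scalerA => ux.
have {ux} : Y ^+ k *: x = 0.
  by rewrite -[LHS]scale1r -(mulVr uu) -scalerA ux scaler0.
elim: k => [|k IHk]; first by rewrite scale1r.
by rewrite exprS -scalerA => /Ltf-/(_ (LZ _ Lx))/IHk.
Qed.

(** Witnesses are taken in [L], so that [L] may be a submodule of a module with
    torsion. *)
Definition divisible_part (x : N) := forall k, exists2 y, L y & x = Y ^+ k *: y.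
Local Notation D := divisible_part.

Lemma divisible_partL x : D x -> L x.
Proof. by move=> /(_ 0%N)[y Ly ->]; apply: LZ. Qed.

Lemma divisible_partP a x y : D x -> D y -> D (a *: x + y).
Proof.
move=> Dx Dy k; have [x' Lx' ->] := Dx k; have [y' Ly' ->] := Dy k.
exists (a *: x' + y'); first exact: LP.
by rewrite scalerDr !scalerA mulrC.
Qed.

Lemma divisible_partX x : L x -> D (Y *: x) -> D x.
Proof.
move=> Lx DYx k; have [y Ly] := DYx k.+1; rewrite exprS -scalerA => Yxy.
exists y => //; apply/eqP; rewrite -subr_eq0; apply/eqP.
by apply: Ltf; [apply: LB => //; apply: LZ|rewrite scalerBr Yxy subrr].
Qed.

Lemma divisible_part_div a x : a != 0 -> D x -> exists2 y, D y & x = a *: y.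
Proof.
case/ps_factor => k [u [uu ->]] Dx.
have [y Dy xy] : exists2 y, D y & x = Y ^+ k *: y.
  have [y Ly xy] := Dx k; exists y => //; rewrite {}xy in Dx.
  elim: k Dx => [|k IHk]; first by rewrite scale1r.
  by rewrite exprS -scalerA => /divisible_partX-/(_ (LZ _ Ly))/IHk.
exists (u^-1 *: y); last by rewrite scalerA mulrK.
rewrite -[X in D X]addr0; apply: divisible_partP => // k'.
by exists 0; rewrite ?scaler0.
Qed.

Variable r : nat.
Hypothesis relL : unit_relations r L.

(** Lifts [n_j] of a basis of [L / Y L] span a free module that meets the
    divisible part trivially.  Expanding [x] modulo [Y] repeatedly gives power
    series [a_j] as coefficients, and the remainder is divisible by all powers
    of [Y]. *)
Lemma free_complement : exists (c : nat) (n : 'I_c -> N),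
  [/\ forall j, L (n j),
      forall x, L x -> exists a : 'I_c -> A, D (x - \sum_j a j *: n j)
    & forall a : 'I_c -> A, D (\sum_j a j *: n j) -> forall j, a j = 0].
Proof.
have [||||c [n [Ln indn maxn]]] := @maximal_independent K r N L
    (fun x => exists2 y, L y & x = Y *: y) (fun a => coefs a 0 = 0) relL.
- by exists 0; rewrite ?scaler0.
- move=> _ _ [x Lx ->] [y Ly ->]; exists (x - y); first exact: LB.
  by rewrite scalerBr.
- by [].
- move=> a y /nonunit_psX[q ->] Ly; exists (q *: y); first exact: LZ.
  by rewrite scalerA.
exists c, n; split=> // [x Lx|a Da j].
  have step (z : {z | L z}) : exists bz : ('I_c -> A) * {z | L z},
      sval z = \sum_j bz.1 j *: n j + Y *: sval bz.2.
    case: z => z Lz /=; have [a [b [/eqP + [y Ly azb]]]] := maxn z Lz.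
    rewrite -unit_psE => ua.
    exists ((fun j => - (a^-1 * b j)), exist L (a^-1 *: y) (LZ _ Ly)) => /=.
    rewrite scalerA mulrC -scalerA -azb scalerDr scalerA mulVr // scale1r.
    rewrite addrCA scaler_sumr -big_split /= big1 ?addr0 // => j _.
    by rewrite scalerA scaleNr addNr.
  (* [z k] is the k-th remainder of [x], and [a j k] the k-th tail of the j-th
     coefficient; then [w k = Y * w (k + 1)]. *)
  have [F FP] := choice step.
  pose z k := iter k (fun z => (F z).2) (exist L x Lx).
  have zS k : sval (z k) = \sum_j (F (z k)).1 j *: n j + Y *: sval (z k.+1).
    exact: FP.
  have [a aP] := choice (fun j => powser_complete (fun k => (F (z k)).1 j)).
  exists (a^~ 0%N); have -> : x = sval (z 0%N) by [].
  pose w k := sval (z k) - \sum_j a j k *: n j.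
  have Lw k : L (w k) by apply: LB; [exact: svalP|exact: Lsum].
  have wS k : w k = Y *: w k.+1.
    rewrite /w zS scalerBr scaler_sumr [RHS]addrC addrAC; congr (_ + _).
    rewrite -sumrB -sumrN; apply: eq_bigr => j _.
    by rewrite aP scalerDl opprD addrA subrr sub0r scalerA.
  move=> k; exists (w k) => //.
  suff wk l : w 0%N = Y ^+ l *: w l by exact: wk.
  elim: l => [|l IHl]; first by rewrite scale1r.
  by rewrite IHl wS scalerA -exprSr.
apply: powserP => k; elim: k a Da => [|k IHk] a Da.
  by apply: indn; have [y Ly ->] := Da 1%N; exists y.
have [b ab] : exists b : 'I_c -> A, forall j, a j = Y * b j.
  suff /choice[b] : forall j, exists b, a j = Y * b by exists b.
  move=> l; apply: nonunit_psX; apply: indn.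
  by have [y Ly ->] := Da 1%N; exists y.
rewrite ab coefsXM IHk //; apply: divisible_partX; first exact: Lsum.
rewrite scaler_sumr (eq_bigr (fun j => a j *: n j)) // => l _.
by rewrite ab scalerA.
Qed.

Lemma divisible_rank : exists (b : nat) (d : 'I_b -> N),
  [/\ forall j, D (d j),
      forall a : 'I_b -> A, \sum_j a j *: d j = 0 -> forall j, a j = 0
    & forall x, D x -> exists s (m : 'I_b -> A),
        s != 0 /\ s *: x = \sum_j m j *: d j].
Proof.
have [|||||b [d [Dd indd maxd]]] := @maximal_independent K r N D
    (fun x => x = 0) (fun a => a = 0).
- by move=> x Dx; apply: relL => j; apply: divisible_partL.
- by [].
- by move=> x y -> ->; rewrite subrr.
- by move=> a ->.
- by move=> a y -> _; rewrite scale0r.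
exists b, d; split=> // x /maxd[s [m [/eqP s0 /eqP]]].
rewrite addr_eq0 => /eqP sx; exists s, (fun j => - m j); split=> //.
by rewrite sx -sumrN; apply: eq_bigr => j _; rewrite scaleNr.
Qed.

End TorsionFree.

(** * The structure of modules with divisible torsion *)

Section Structure.
Variable K : fieldType.
Local Notation A := (powser K).
Local Notation Y := (psX K).
Variables (E : lmodType A) (i : {linear residue_module K -> E}).
Hypothesis E_hull : is_injective_hull i.
Variables (N : lmodType A).

Lemma fraction_moduleZ a (q : fraction_module K) :
  a *: q = (FracField.tofrac a * (q : {fraction A}) : {fraction A}).
Proof. by []. Qed.

Lemma fraction_common (b : nat) (q : 'I_b -> {fraction A}) :
  exists (s : A) (m : 'I_b -> A),
    s != 0 /\ forall j, q j * FracField.tofrac s = FracField.tofrac (m j).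
Proof.
have [x xP] : exists x : 'I_b -> A * A, forall j,
    (x j).2 != 0 /\ q j * FracField.tofrac (x j).2 = FracField.tofrac (x j).1.
  suff /choice[x] : forall j, exists x : A * A, x.2 != 0 /\
      q j * FracField.tofrac x.2 = FracField.tofrac x.1 by exists x.
  move=> j; elim/quotW: (q j) => y; exists (\n_y, \d_y).
  split; first exact: denom_ratioP.
  rewrite /FracField.tofrac; unlock; rewrite /GRing.mul /= !piE.
  apply/eqP; rewrite piE /FracField.mulf /equivf /=.
  rewrite !numden_Ratio ?(oner_neq0, mulf_neq0, denom_ratioP) //.
  by rewrite !mulr1 mulrC.
exists (\prod_j (x j).2), (fun j => (x j).1 * \prod_(l | l != j) (x l).2).
split=> [|j]; first by apply/prodf_neq0 => j _; case: (xP j).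
by rewrite (bigD1 j) //= rmorphM mulrA; case: (xP j) => _ ->; rewrite -rmorphM.
Qed.

(** In the graph [P] the [E]-part of [x] is [f x]; the other two parts are read
    off a multiple [s x], with [s] a common denominator of the [Q(A)]-part that
    also kills the torsion part of [x]. *)
Theorem divisible_torsion_decomposition (r : nat) :
  (forall x : N, Y *: x = 0 -> forall k, exists y, x = Y ^+ k *: y) ->
  unit_relations r (fun _ : N => True) ->
  exists a b c : nat,
    lmod_iso N ({ffun 'I_a -> E} * {ffun 'I_b -> fraction_module K} *
                {ffun 'I_c -> A^o})%type.
Proof.
move=> N_div relN.
have [a [f [f_inj f_surj]]] := split_torsion E_hull N_div relN.
pose L x := f x = 0.
have L0 : L 0 by exact: linear0.
have LP b x y : L x -> L y -> L (b *: x + y).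
  by rewrite /L linearP => -> ->; rewrite scaler0 addr0.
have Ltf x : L x -> Y *: x = 0 -> x = 0.
  by move=> Lx Yx; apply: f_inj => //; exists 1%N.
have relL : unit_relations r L by move=> x _; apply: relN.
have [c [n [Ln DLn n_free]]] := free_complement L0 LP Ltf relL.
have [b [d [Dd d_free d_max]]] := divisible_rank L0 LP relL.
pose D := divisible_part L.
have DP : forall a x y, D x -> D y -> D (a *: x + y) := divisible_partP LP.
have DL : forall x, D x -> L x := divisible_partL L0 LP.
have D0 : D 0 by move=> k; exists 0 => //; rewrite scaler0.
have DZ e x : D x -> D (e *: x).
  by move=> Dx; rewrite -[X in D X]addr0; apply: DP.
have Dsum (m : 'I_b -> A) : D (\sum_j m j *: d j).
  apply: (big_ind D) => // [x' y' Lx' Ly'|j _]; last exact/DZ/Dd.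
  by rewrite -[x']scale1r; apply: DP.
have Lsum (m : 'I_c -> A) : L (\sum_j m j *: n j).
  apply: (big_ind L) => // [x' y' Lx' Ly'|j _].
    by rewrite -[x']scale1r; apply: LP.
  by rewrite -[_ *: _]addr0; apply: LP.
exists a, b, c.
pose P (x : N) (w : ({ffun 'I_a -> E} * {ffun 'I_b -> fraction_module K} *
                     {ffun 'I_c -> A^o})%type) :=
  f x = w.1.1 /\ exists (s : A) (m : 'I_b -> A),
    [/\ s != 0, forall j, (w.1.2 j : {fraction A}) * FracField.tofrac s
                          = FracField.tofrac (m j)
      & s *: x = \sum_j m j *: d j + s *: \sum_j (w.2 j : A) *: n j].
apply: (@lmod_iso_of_graph _ _ _ P).
- move=> x; have [t [k tk] ft] := f_surj (f x).
  have Lxt : L (x - t) by rewrite /L linearB /= ft subrr.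
  have [e De] := DLn _ Lxt; have [s [m [s0 sm]]] := d_max _ De.
  pose q j : fraction_module K := FracField.tofrac (m j) / FracField.tofrac s.
  exists (f x, [ffun j => q j], [ffun j => e j : A^o]).
  split=> //; exists (Y ^+ k * s), (fun j => Y ^+ k * m j); split=> [|j|] /=.
  + by rewrite mulf_neq0 // expf_neq0 // psX_neq0.
  + by rewrite ffunE /q !rmorphM mulrCA divfK // tofrac_eq0.
  have -> : \sum_j [ffun j => e j : A^o] j *: n j = \sum_j e j *: n j.
    by apply: eq_bigr => j _; rewrite ffunE.
  under eq_bigr do rewrite -scalerA.
  rewrite -scaler_sumr -sm -[in RHS]scalerA -!scalerDr subrK scalerA.
  by rewrite scalerBr (_ : _ *: t = 0) ?subr0 // mulrC -scalerA tk scaler0.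
- move=> y; have [t [k tk] ft] := f_surj y.1.1.
  have [s [m [s0 ms]]] := fraction_common (fun j => y.1.2 j : {fraction A}).
  have [e De em] := divisible_part_div L0 LP Ltf s0 (Dsum m).
  exists (t + e + \sum_j (y.2 j : A) *: n j); split.
    have Lg := Lsum (fun j => y.2 j : A).
    by rewrite !linearD /= ft (DL _ De) Lg !addr0.
  exists (Y ^+ k * s), (fun j => Y ^+ k * m j); split=> [|j|].
  + by rewrite mulf_neq0 // expf_neq0 // psX_neq0.
  + by rewrite !rmorphM mulrCA ms.
  rewrite scalerDr; congr (_ + _).
  under eq_bigr do rewrite -scalerA.
  rewrite -scaler_sumr em scalerDr mulrC -[in X in X + _ = _]scalerA tk.
  by rewrite scaler0 add0r scalerA mulrC.
- move=> e x w x' w' [fx [s [m [s0 ms sx]]]] [fx' [s' [m' [s0' ms' sx']]]].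
  split; first by rewrite linearP /= fx fx'.
  exists (s * s'), (fun j => e * s' * m j + s * m' j); split=> [|j|].
  + by rewrite mulf_neq0.
  + rewrite /= !ffunE fraction_moduleZ tofracD !tofracM mulrDl -ms -ms'.
    congr (_ + _); last by rewrite mulrCA.
    by rewrite (mulrC (FracField.tofrac s)) mulrACA.
  have -> : (s * s') *: (e *: x + x') = (e * s') *: (s *: x) + s *: (s' *: x').
    rewrite scalerDr !scalerA; congr (_ *: _ + _).
    by rewrite mulrC -mulrA (mulrC s).
  rewrite sx sx' !scalerDr addrACA; congr (_ + _).
    rewrite !scaler_sumr -big_split; apply: eq_bigr => j _ /=.
    by rewrite scalerDl !scalerA.
  rewrite !scaler_sumr -big_split; apply: eq_bigr => j _ /=.
  rewrite !ffunE !scalerA -scalerDl; congr (_ *: _).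
  rewrite mulrDr -[e *: w.2 j]/(e * (w.2 j : A)); congr (_ + _).
  by rewrite mulrACA [RHS]mulrACA (mulrC e).
- move=> [[u q] g] [/= fu [s [m [s0 ms]]]]; rewrite linear0 in fu.
  rewrite scaler0 => /esym/eqP; rewrite addrC addr_eq0 => /eqP sg.
  have g0 j : g j = 0.
    have : s * (g j : A) = 0.
      apply: (n_free (fun j => s * g j)); under eq_bigr do rewrite -scalerA.
      rewrite -scaler_sumr sg -sumrN.
      under eq_bigr do rewrite -scaleNr.
      exact: Dsum.
    by move/eqP; rewrite mulf_eq0 (negbTE s0) => /eqP.
  have m0 : forall j, m j = 0.
    apply: d_free; apply/eqP; rewrite -oppr_eq0 -sg big1 ?scaler0 // => j _.
    by rewrite g0 scale0r.
  congr (_, _, _) => //; apply/ffunP => j; rewrite ffunE ?g0 //.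
  have /eqP := ms j; rewrite m0 rmorph0 mulf_eq0 tofrac_eq0 (negbTE s0) orbF.
  by move/eqP.
- move=> x [/= fx [s [m [s0 ms sx]]]].
  apply: (torsion_free_scale L0 LP Ltf s0 fx).
  rewrite sx !big1 ?scaler0 ?addr0 // => j _; first by rewrite ffunE scale0r.
  have /eqP := ms j; rewrite ffunE mul0r eq_sym tofrac_eq0 => /eqP ->.
  by rewrite scale0r.
Qed.

End Structure.

(** * Finitely generated modules over the valuation ring *)

Section CyclicDecomposition.
Variable K : fieldType.
Local Notation A := (powser K).
Local Notation Y := (psX K).

Lemma dividesXn k (a : A) : (forall l, (l < k)%N -> coefs a l = 0) ->
  exists b, a = Y ^+ k * b /\ coefs b 0 = coefs a k.
Proof.
elim: k a => [|k IHk] a ak; first by exists a; rewrite mul1r.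
have [b aE] := nonunit_psX (ak 0%N isT).
have [|c [bE c0]] := IHk b.
  by move=> l lk; have := ak l.+1 lk; rewrite aE coefsXM.
by exists c; rewrite c0 {2}aE coefsXM aE bE exprS mulrA.
Qed.

(** If [k] is the least valuation of a coefficient in any relation among the
    [n_i], attained at [n_j], then dividing that relation by [Y^k] gives an
    element [m] that can replace [n_j], is killed by [Y^k], and in any relation
    occurs with a coefficient divisible by [Y^k].  So [m] generates a direct
    summand isomorphic to [A / Y^k]. *)
Lemma cyclic_decomposition (V : lmodType A) (r : nat) (n : 'I_r -> V) :
  exists (w : 'I_r -> V) (d : 'I_r -> A),
    [/\ forall j, span_of n (w j), forall j, span_of w (n j)
      & forall a : 'I_r -> A,
          \sum_j a j *: w j = 0 <-> forall j, divides (d j) (a j)].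
Proof.
elim: r n => [|r IHr] n.
  exists n, (fun=> 0); split=> [[]|[]|a] //.
  by rewrite big_ord0; split=> // _ [].
(* [Q k]: some relation has a coefficient of valuation at most [k]. *)
pose Q k := `[< exists (a : 'I_r.+1 -> A) j,
                 \sum_i a i *: n i = 0 /\ coefs (a j) k != 0 >].
have [exQ|nQ] := pselect (exists k, Q k); last first.
  exists n, (fun=> 0); split=> [j|j|a]; try exact: span_of_gen.
  split=> [a0 j|a0]; last first.
    by rewrite big1 // => j _; have [q ->] := a0 j; rewrite mulr0 scale0r.
  exists 0; rewrite mul0r; apply: powserP => k; apply/eqP.
  apply: contrapT => /negP ajk; apply: nQ; exists k.
  by apply/asboolP; exists a, j.
case: (ex_minnP exQ) => k /asboolP[a [j [a0 ajk]]] mink {exQ}.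
have small (b : 'I_r.+1 -> A) i : \sum_i b i *: n i = 0 ->
    forall l, (l < k)%N -> coefs (b i) l = 0.
  move=> b0 l lk; apply/eqP; apply: contraLR lk => bil; rewrite -leqNgt.
  by apply: mink; apply/asboolP; exists b, i.
have [a' a'P] := choice (fun i => dividesXn (small a i a0)).
have ua : a' j \is a GRing.unit by rewrite unit_psE; case: (a'P j) => _ ->.
pose m := \sum_i a' i *: n i.
have Ym : Y ^+ k *: m = 0.
  rewrite -a0 scaler_sumr; apply: eq_bigr => i _.
  by rewrite scalerA; case: (a'P i) => <-.
have [w [d [nw wn wP]]] := IHr (fun i => n (lift j i)).
pose w' i := if unlift j i is Some l then w l else m.
have w'j : w' j = m by rewrite /w' unlift_none.
have w'l l : w' (lift j l) = w l by rewrite /w' liftK.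
exists w', (fun i => if unlift j i is Some l then d l else Y ^+ k).
have w'nl l : span_of w' (n (lift j l)).
  apply: span_of_trans (wn l) => i; rewrite -w'l; exact: span_of_gen.
have nwl l : span_of n (w l).
  apply: span_of_trans (nw l) => i; exact: span_of_gen.
split=> [i|i|b].
- rewrite /w'; case: unliftP => [l _|_] //.
  by apply: span_of_sum => l _; apply/span_ofZ/span_of_gen.
- case: (unliftP j i) => [l ->|->] //.
  have -> : n j = (a' j)^-1 *: (m - \sum_l a' (lift j l) *: n (lift j l)).
    by rewrite /m (bigD1_ord j) //= addrK scalerA mulVr // scale1r.
  apply/span_ofZ/span_ofD; first by rewrite -w'j; exact: span_of_gen.
  rewrite -sumrN; apply: span_of_sum => l _.
  by rewrite -scaleNr; apply: span_ofZ.
rewrite (bigD1_ord j) //= w'j; under eq_bigr do rewrite w'l.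
have dvd_bm q : divides (Y ^+ k) q -> q *: m = 0.
  by case=> c ->; rewrite -scalerA Ym scaler0.
split=> [b0|bd].
  have Ykb : divides (Y ^+ k) (b j).
    have [c cE] : span_of (fun i => n (lift j i)) (\sum_l b (lift j l) *: w l).
      by apply: span_of_sum => l _; apply: span_ofZ.
    pose e i := if unlift j i is Some l then b j * a' i + c l else b j * a' j.
    have e0 : \sum_i e i *: n i = 0.
      rewrite -[RHS]b0 cE /m [in RHS](bigD1_ord j) //= (bigD1_ord j) //= /e.
      rewrite unlift_none scalerDr scalerA -addrA; congr (_ + _).
      rewrite scaler_sumr -big_split; apply: eq_bigr => l _ /=.
      by rewrite liftK scalerDl scalerA.
    have [q [ejq _]] := dividesXn (small e j e0).
    exists (q / a' j); move: ejq; rewrite /e unlift_none => bq.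
    by rewrite mulrAC [q * _]mulrC -bq mulrK.
  have /wP bd : \sum_l b (lift j l) *: w l = 0.
    by rewrite -[RHS]b0 dvd_bm // add0r.
  by move=> i; case: unliftP => [l ->|->].
have := bd j; rewrite unlift_none => /dvd_bm ->; rewrite add0r.
by apply/wP => l; have := bd (lift j l); rewrite liftK.
Qed.

End CyclicDecomposition.

(** * The Frobenius functor on formal sums *)

Section FrobeniusLift.
Variables (R : comNzRingType) (p : nat) (M : lmodType R) (G : zmodType).
Variable g : R -> M -> G.
Hypotheses (gDl : forall r s m, g (r + s) m = g r m + g s m)
  (gDr : forall r m m', g r (m + m') = g r m + g r m')
  (g_bal : forall r a m, g (r * a ^+ p) m = g r (a *: m)).

Let g0l m : g 0 m = 0.
Proof. by apply: (addrI (g 0 m)); rewrite -gDl !addr0. Qed.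

Let h (z : tens_free R^o M) : G :=
  \sum_(t <- dom z) g (coeff t z * (t.1 : R)) t.2.

Let h_sub (z : tens_free R^o M) (s : seq (R^o * M)) :
  uniq s -> {subset dom z <= s} ->
  h z = \sum_(t <- s) g (coeff t z * (t.1 : R)) t.2.
Proof.
move=> us zs; rewrite (bigID (fun t => t \in dom z)) /= [X in _ + X]big1 ?addr0.
  rewrite -big_filter; apply: perm_big; apply: uniq_perm => [||t].
  - exact: uniq_dom.
  - exact: filter_uniq.
  by rewrite mem_filter; case: (boolP (t \in dom z)) => // /zs.
by move=> t tz; rewrite coeff_outdom // mul0r g0l.
Qed.

Let hD x y : h (x + y) = h x + h y.
Proof.
pose s := undup (dom x ++ dom y); have us : uniq s by exact: undup_uniq.
rewrite !(h_sub us); last 3 first.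
- by move=> t ty; rewrite mem_undup mem_cat ty orbT.
- by move=> t tx; rewrite mem_undup mem_cat tx.
- by move=> t /domD_subset; rewrite mem_undup.
by rewrite -big_split; apply: eq_bigr => t _ /=; rewrite coeffD mulrDl gDl.
Qed.

Let h0 : h 0 = 0.
Proof. by apply: (addrI (h 0)); rewrite -hD !addr0. Qed.

Let hN x : h (- x) = - h x.
Proof. by apply: (addrI (h x)); rewrite -hD !subrr h0. Qed.

Let h_gen a (b : R^o) m : h (a *: tens_gen b m) = g (a * b) m.
Proof.
have genE : a *: tens_gen b m = << a *g (b, m) >>.
  by apply/eqP/freeg_eqP => t; rewrite coeffZ !coeffU mul1r.
rewrite genE (@h_sub _ [:: (b, m)]) //; last first.
  move=> t; rewrite mem_dom coeffU inE.
  by rewrite [t == _]eq_sym; case: (_ == t); rewrite // mulr0 eqxx.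
by rewrite big_seq1 coeffU eqxx mulr1.
Qed.

Let h_rel a z : tens_rel (frob_ract p) z -> h (a *: z) = 0.
Proof.
case=> [b b' m|b m m'|b c m|c b m];
  rewrite !(scalerBr, scalerDr) !(hD, hN) !h_gen.
- by rewrite mulrDr gDl subrr.
- by rewrite gDr subrr.
- by rewrite -g_bal mulrA subrr.
- by rewrite scalerA h_gen mulrA subrr.
Qed.

(** The universal property of the tensor product for additive maps.  The maps
    needed below are linear over [A] only, so lifting [R]-linear maps out of
    the quotient would not suffice. *)
Lemma frob_lift : exists f : frob p M -> G,
  {morph f : x y / x + y} /\ forall r m, f (frob_tens p r m) = g r m.
Proof.
have h_span z z' : lquot_pi (tens_rel (frob_ract p) (M := M)) z =
    lquot_pi (tens_rel (frob_ract p) (M := M)) z' -> h z = h z'.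
  move=> /lquot_piP[s sr zz']; apply/eqP; rewrite -subr_eq0 -hN -hD zz'.
  apply/eqP; rewrite big_seq; apply: (big_ind (fun z => h z = 0)) => //.
    by move=> x y hx hy; rewrite hD hx hy addr0.
  by move=> t /sr; exact: h_rel.
exists (fun x => h (lquot_repr x)); split=> [x y|r m].
  by rewrite -hD; apply: h_span; rewrite lquot_piD !lquot_reprK.
rewrite -[r in RHS]mul1r -h_gen scale1r; apply: h_span.
by rewrite lquot_reprK.
Qed.

End FrobeniusLift.

Section FrobeniusGen.
Variables (R : comNzRingType) (p : nat) (M : lmodType R).

Lemma frob_ind (P : frob p M -> Prop) :
  P 0 -> (forall x y, P x -> P y -> P (x + y)) ->
  (forall r m, P (frob_tens p r m)) -> forall x, P x.
Proof.
move=> P0 PD Pt x; rewrite -(lquot_reprK x) -(freeg_sumE (lquot_repr x)).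
rewrite (linear_sum (lquot_pi (tens_rel (frob_ract p) (M := M)))).
apply: (big_ind P) => // -[b m] _.
have -> : << coeff (b, m) (lquot_repr x) *g (b, m) >> =
    coeff (b, m) (lquot_repr x) *: tens_gen b m.
  by apply/eqP/freeg_eqP => t; rewrite coeffZ !coeffU mul1r.
rewrite (linearZ_LR (lquot_pi (tens_rel (frob_ract p) (M := M)))).
have := Pt (coeff (b, m) (lquot_repr x) *: b) m.
by rewrite /frob_tens tensZl.
Qed.

End FrobeniusGen.

(** * The Frobenius functor on graded components *)

Section GradedFrobenius.
Variables (A : comNzRingType) (p n : nat).
Hypothesis charA : p \in [pchar A].
Local Notation R := {mpoly A[n]}.
Local Notation Zn := 'rV[int]_n.

Let p_gt0 : (0 < p)%N.
Proof. by apply: prime_gt0; case/andP: charA. Qed.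

Lemma pchar_mpoly : p \in [pchar R].
Proof.
move: charA; rewrite !inE => /andP[-> /eqP p0] /=.
by rewrite -(rmorph_nat (@mpolyC n A)) p0 rmorph0.
Qed.

Lemma expr_pcharD (a b : A) : (a + b) ^+ p = a ^+ p + b ^+ p.
Proof.
have := pFrobenius_autD_comm charA (mulrC a b).
by rewrite !pFrobenius_autE.
Qed.

Lemma mpoly_expr_pcharD (a b : R) : (a + b) ^+ p = a ^+ p + b ^+ p.
Proof.
have := pFrobenius_autD_comm pchar_mpoly (mulrC a b).
by rewrite !pFrobenius_autE.
Qed.

Section PowerMap.
Variable d : A.

(** The p-th power map [A / d -> A / d^p]: in characteristic [p], if [d]
    divides [a - b], then [d^p] divides [(a - b)^p = a^p - b^p]. *)
Definition cyclic_frob (x : cyclic_mod d) : cyclic_mod (d ^+ p) :=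
  cyclic_class (d ^+ p) (cyclic_repr x ^+ p).

Lemma cyclic_frobE a :
  cyclic_frob (cyclic_class d a) = cyclic_class (d ^+ p) (a ^+ p).
Proof.
apply/cyclic_class_eq; have : divides d (cyclic_repr (cyclic_class d a) - a).
  by apply/cyclic_class_eq; exact: cyclic_reprK.
move: (cyclic_repr _) => b [q bE]; exists (q ^+ p).
by rewrite -exprMn -bE -[b in LHS](subrK a) expr_pcharD addrK.
Qed.

Lemma cyclic_frobD x y : cyclic_frob (x + y) = cyclic_frob x + cyclic_frob y.
Proof.
have [a ->] := cyclic_class_surj x; have [b ->] := cyclic_class_surj y.
by rewrite -cyclic_classD !cyclic_frobE expr_pcharD cyclic_classD.
Qed.

Lemma cyclic_frobZ a x : cyclic_frob (a *: x) = a ^+ p *: cyclic_frob x.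
Proof.
have [b ->] := cyclic_class_surj x.
by rewrite -cyclic_classZ !cyclic_frobE exprMn cyclic_classZ.
Qed.

End PowerMap.

Definition mdiv (m : 'X_{1..n}) : 'X_{1..n} := [multinom (m i %/ p)%N | i < n].
Definition mmod (m : 'X_{1..n}) : 'X_{1..n} := [multinom (m i %% p)%N | i < n].

Lemma mmod_mdiv m : m = (mmod m + mdiv m *+ p)%MM.
Proof. by apply/mnmP => i; rewrite mnmDE mulmnE !mnmE addnC -divn_eq. Qed.

Lemma mdivDMn m k : mdiv (m + k *+ p) = (mdiv m + k)%MM.
Proof.
by apply/mnmP => i; rewrite !(mnmDE, mulmnE, mnmE) addnC divnMDl // addnC.
Qed.

Lemma mmodDMn m k : mmod (m + k *+ p) = mmod m.
Proof. by apply/mnmP => i; rewrite !(mnmDE, mulmnE, mnmE) addnC modnMDl. Qed.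

Section Functional.
Variables (W : lmodType R) (d : A).
Local Notation WA := (restrict (@mpolyC n A) W).
Variables (c : {linear WA -> cyclic_mod d}) (al : 'X_{1..n}).

(* [psi r m] sends the pure tensor of [X^(al + p k)] and [m] to the p-th power
   of [c (X^k m)], and monomials outside of [al + p N^n] to 0. *)
Let F (m : W) (g : 'X_{1..n}) : cyclic_mod (d ^+ p) :=
  if mmod g == al then cyclic_frob (c ('X_[mdiv g] *: m)) else 0.

Let psi (r : R) (m : W) : cyclic_mod (d ^+ p) := fglift (F m) (mpoly_val r).

Let psiDl r s m : psi (r + s) m = psi r m + psi s m.
Proof.
have B := lift_is_additive (F m).
have h0 : fglift (F m) 0 = 0 by rewrite -[X in fglift _ X](subrr 0) B subrr.
have BN z : fglift (F m) (- z) = - fglift (F m) z by rewrite -sub0r B h0 sub0r.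
have D x y : fglift (F m) (x + y) = fglift (F m) x + fglift (F m) y.
  by rewrite -[y in LHS]opprK B BN opprK.
exact: D.
Qed.

Let psi0 m : psi 0 m = 0.
Proof. by apply: (addrI (psi 0 m)); rewrite -psiDl !addr0. Qed.

Let psiX a g m : psi (a *: 'X_[g]) m = a *: F m g.
Proof. by rewrite -MPolyU /psi /= liftU. Qed.

Let FD m m' g : F (m + m') g = F m g + F m' g.
Proof.
rewrite /F; case: ifP => _; last by rewrite addr0.
by rewrite scalerDr linearD cyclic_frobD.
Qed.

Let psiDr r m m' : psi r (m + m') = psi r m + psi r m'.
Proof.
elim/mpolyind: r => [|a g r _ _ IHr]; first by rewrite !psi0 addr0.
by rewrite !psiDl IHr !psiX FD scalerDr addrACA.
Qed.

Let psiZ a r m : psi (a *: r) m = a *: psi r m.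
Proof.
elim/mpolyind: r => [|b g r _ _ IHr]; first by rewrite !(scaler0, psi0).
by rewrite scalerDr !psiDl IHr scalerDr scalerA !psiX scalerA.
Qed.

Let psi_bal r a m : psi (r * a ^+ p) m = psi r (a *: m).
Proof.
elim/mpolyind: a r => [|a g b _ _ IHb] r.
  rewrite expr0n gtn_eqF // mulr0 scale0r psi0.
  by apply: (addrI (psi r 0)); rewrite -psiDr !addr0.
rewrite mpoly_expr_pcharD mulrDr psiDl IHb scalerDl psiDr; congr (_ + _).
elim/mpolyind: r {b IHb} => [|b h r _ _ IHr]; first by rewrite mul0r !psi0.
rewrite mulrDl !psiDl IHr; congr (_ + _).
rewrite exprZn mpolyXn -scalerAl -scalerAr scalerA -mpolyXD !psiX.
rewrite -scalerA; congr (_ *: _); rewrite /F mmodDMn.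
case: ifP => _; last by rewrite scaler0.
rewrite mdivDMn -cyclic_frobZ; congr cyclic_frob.
rewrite -linearZ_LR; congr (c _); rewrite scalerA -scalerAr -mul_mpolyC mpolyXD.
by rewrite -[RHS]scalerA.
Qed.

(** A coordinate [c] on [W] induces a coordinate on [F(W)], picking out the
    summand of [F(W)] that is spanned by the [X^al (x) m]. *)
Lemma frob_functional : (forall i, al i < p)%N ->
  exists c' : {linear restrict (@mpolyC n A) (frob p W) -> cyclic_mod (d ^+ p)},
    forall m, c' (frob_tens p 'X_[al] m) = cyclic_frob (c m).
Proof.
move=> alp; have al_mod : mmod al = al.
  by apply/mnmP => i; rewrite mnmE modn_small.
have al_div : mdiv al = 0%MM.
  by apply/mnmP => i; rewrite mnm0E mnmE divn_small.
have [f [fD ft]] := frob_lift psiDl psiDr psi_bal.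
have f0 : f 0 = 0 by apply: (addrI (f 0)); rewrite -fD !addr0.
have fZ (a : A) (x : frob p W) : f (a%:MP_[n] *: x) = a *: f x.
  elim/frob_ind: x => [|x y IHx IHy|r m]; first by rewrite scaler0 f0 scaler0.
    by rewrite scalerDr !fD IHx IHy scalerDr.
  rewrite /frob_tens -tensZl (mul_mpolyC a r : a%:MP *: (r : R^o) = _).
  by rewrite -!/(frob_tens p _ m) !ft psiZ.
have f_lin :
    linear (f : restrict (@mpolyC n A) (frob p W) -> cyclic_mod (d ^+ p)).
  by move=> a x y; rewrite fD; congr (_ + _); exact: fZ.
pose f' := GRing.isLinear.Build A (restrict (@mpolyC n A) (frob p W))
  (cyclic_mod (d ^+ p)) _ f f_lin.
pose c' : {linear restrict (@mpolyC n A) (frob p W) -> cyclic_mod (d ^+ p)} :=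
  HB.pack (f : restrict (@mpolyC n A) (frob p W) -> cyclic_mod (d ^+ p)) f'.
by exists c' => m; rewrite [LHS]ft -['X_[al]]scale1r psiX scale1r /F al_mod eqxx
  al_div mpolyX0 scale1r.
Qed.

End Functional.

Definition graded_closed (W : lmodType R) (G : Zn -> W -> Prop) : Prop :=
  forall u v r x, homogeneous u r -> G v x -> G (u + v) (r *: x).

(** The [w_j] decompose the component of degree [u] as the direct sum of the
    modules [A / d_j].  Their independence is expressed by coordinate maps on
    all of [W], because frob_functional evaluates the coordinates on multiples
    of elements of any degree. *)
Definition cyclic_component (W : lmodType R) (G : Zn -> W -> Prop) (u : Zn)
    (r : nat) (w : 'I_r -> W) (d : 'I_r -> A) : Prop :=
  [/\ forall j, G u (w j),
      forall x, G u x -> span_of (w : 'I_r -> restrict (@mpolyC n A) W) x,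
      forall j, (d j)%:MP_[n] *: w j = 0
    & forall j,
      exists c : {linear restrict (@mpolyC n A) W -> cyclic_mod (d j)},
        forall l, c (w l) = cyclic_class (d j) (l == j)%:R].

Definition floor_degree (u : Zn) : Zn := \row_i (u ord0 i %/ p%:Z)%Z.
Definition residue_mnm (u : Zn) : 'X_{1..n} :=
  [multinom `|(u ord0 i %% p%:Z)%Z|%N | i < n].

Lemma residue_mnmE u i : (residue_mnm u i)%:Z = (u ord0 i %% p%:Z)%Z.
Proof. by rewrite mnmE gez0_abs // modz_ge0 // eqz_nat -lt0n. Qed.

Lemma residue_mnm_lt u i : (residue_mnm u i < p)%N.
Proof.
by rewrite -ltz_nat residue_mnmE ltz_pmod // ltz_nat.
Qed.

Lemma floor_residue u : mnm_degree (residue_mnm u) + floor_degree u *+ p = u.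
Proof.
apply/rowP => i; rewrite !mxE residue_mnmE addrC mulmxnE mxE -mulr_natr.
by rewrite natz -divz_eq.
Qed.

(** A monomial [m] and a degree [v] contribute to degree [u] of [F(W)] only if
    the exponents of [m] agree with [u] modulo [p]; the quotient of [m] by [p]
    then moves degree [v] to [floor (u / p)]. *)
Lemma floor_residue_mnm m v u : mnm_degree m + v *+ p = u ->
  mmod m = residue_mnm u /\ mnm_degree (mdiv m) + v = floor_degree u.
Proof.
move=> <-; split.
  apply/mnmP => i; apply/eqP; rewrite -eqz_nat residue_mnmE !mxE mnmE.
  by rewrite mulmxnE -mulr_natr natz addrC modzMDl modz_nat.
apply/rowP => i; rewrite !mxE mnmE mulmxnE -mulr_natr natz [in RHS]addrC.
by rewrite divzMDl ?eqz_nat -?lt0n // divz_nat addrC.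
Qed.

Lemma frob_tensZC (W : lmodType R) r (a : A) (m : W) :
  frob_tens p r (a%:MP_[n] *: m) = (a ^+ p)%:MP_[n] *: frob_tens p r m.
Proof.
rewrite /frob_tens -tens_balanced -tensZl; congr (tens _ _ _).
by rewrite /frob_ract -rmorphXn mulrC.
Qed.

Lemma frob_tens0r (W : lmodType R) (r : R) : frob_tens p r (0 : W) = 0.
Proof.
apply: (addrI (frob_tens p r (0 : W))).
by rewrite -[LHS]tensDr !addr0.
Qed.

Lemma frob_tens0l (W : lmodType R) (m : W) : frob_tens p 0 m = 0.
Proof.
apply: (addrI (frob_tens p (0 : R) m)).
by rewrite -[LHS](tensDl (frob_ract p)) !addr0.
Qed.

Lemma frob_tens_suml (W : lmodType R) (T : Type) (s : seq T) (P : pred T)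
    (F : T -> R) (m : W) :
  frob_tens p (\sum_(t <- s | P t) F t) m =
  \sum_(t <- s | P t) frob_tens p (F t) m.
Proof.
apply: (big_morph (fun r => frob_tens p r m)); last exact: frob_tens0l.
by move=> r r'; exact: tensDl.
Qed.

Lemma frob_tens_sumr (W : lmodType R) (T : Type) (s : seq T) (P : pred T)
    (F : T -> W) (r : R) :
  frob_tens p r (\sum_(t <- s | P t) F t) =
  \sum_(t <- s | P t) frob_tens p r (F t).
Proof.
apply: (big_morph (frob_tens p r)); last exact: frob_tens0r.
by move=> m m'; exact: tensDr.
Qed.

Lemma homogeneousX m : homogeneous (mnm_degree m) ('X_[m] : R).
Proof. by move=> m'; rewrite msuppX inE => /eqP ->. Qed.

(** In degree [u] every pure tensor can be brought to the form [X^al (x) m] with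
    [al] the residue of [u] and [m] of degree [floor (u / p)], by moving p-th
    powers of monomials across the tensor sign.  The coefficient of [w_j] gets
    raised to the power [p] on the way, which turns [d_j] into [d_j^p]. *)
Lemma frob_cyclic_component (W : lmodType R) (G : Zn -> W -> Prop) (u : Zn)
    (r : nat) (w : 'I_r -> W) (d : 'I_r -> A) :
  graded_closed G -> cyclic_component G (floor_degree u) w d ->
  cyclic_component (@frob_gcomp A n p W G) u
    (fun j => frob_tens p 'X_[residue_mnm u] (w j)) (fun j => d j ^+ p).
Proof.
move=> Gcl [Gw Gspan dw Gc]; split=> [j|x [s sP ->]|j|j].
- exists [:: ('X_[residue_mnm u], w j)]; last by rewrite big_seq1.
  move=> t; rewrite inE => /eqP -> /=.
  exists (mnm_degree (residue_mnm u)), (floor_degree u); split=> //.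
    exact: homogeneousX.
  exact: floor_residue.
- rewrite big_seq; apply: span_of_sum => t /sP[v [v' [hom_t Gt vu]]].
  rewrite [t.1]mpolyE frob_tens_suml big_seq.
  apply: span_of_sum => g /hom_t gv; rewrite -gv in vu.
  have [gmod gdiv] := floor_residue_mnm vu.
  rewrite -mul_mpolyC /frob_tens.
  rewrite (tensZl (frob_ract p) (t.1@_g)%:MP ('X_[g] : R^o)).
  apply: (@span_ofZ _ (restrict (@mpolyC n A) (frob p W))).
  have -> : tens (frob_ract p) ('X_[g] : R^o) t.2 =
      frob_tens p 'X_[residue_mnm u] ('X_[mdiv g] *: t.2).
    rewrite /frob_tens -tens_balanced /frob_ract mpolyXn -mpolyXD -gmod.
    by rewrite -mmod_mdiv.
  have [|a ->] := Gspan ('X_[mdiv g] *: t.2).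
    by rewrite -gdiv; apply: Gcl => //; exact: homogeneousX.
  exists (fun j => a j ^+ p); rewrite frob_tens_sumr.
  by apply: eq_bigr => j _; exact: frob_tensZC.
- by rewrite -frob_tensZC dw frob_tens0r.
have [c cP] := Gc j; have [c' c'P] := frob_functional c (residue_mnm_lt u).
exists c' => l; rewrite c'P cP cyclic_frobE; congr cyclic_class.
by case: (l == j); rewrite ?expr1n // expr0n gtn_eqF.
Qed.

End GradedFrobenius.

(** * Components of finitely generated graded modules *)

Section GradedModules.
Variables (A : comNzRingType) (n : nat).
Local Notation R := {mpoly A[n]}.
Local Notation Zn := 'rV[int]_n.
Variables (U : lmodType R) (G : grading U).
Local Notation UA := (restrict (@mpolyC n A) U).

Lemma gcompN u x : G u x -> G u (- x).
Proof. by move=> Gx; rewrite -sub0r; apply: gcompB => //; apply: gcomp0. Qed.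

Lemma gcompD u x y : G u x -> G u y -> G u (x + y).
Proof. by move=> Gx Gy; rewrite -[y]opprK; apply/gcompB/gcompN. Qed.

Lemma gcompC u a x : G u x -> G u (a%:MP_[n] *: x).
Proof.
by move=> Gx; rewrite -[u]add0r; apply: gcompZ Gx; exact: homogeneousC.
Qed.

Lemma gcomp_sum u (T : Type) (s : seq T) (P : pred T) F :
  (forall t, P t -> G u (F t)) -> G u (\sum_(t <- s | P t) F t).
Proof. by move=> GF; apply: big_ind => //; [exact: gcomp0|exact: gcompD]. Qed.

Lemma gcomp_span_of u r (w : 'I_r -> U) x :
  (forall j, G u (w j)) -> span_of (w : 'I_r -> UA) x -> G u x.
Proof. by move=> Gw [a ->]; apply: gcomp_sum => j _; apply: gcompC. Qed.

Lemma homogeneous_generators : fin_gen U ->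
  exists (r : nat) (h : 'I_r -> U) (deg : 'I_r -> Zn),
    (forall j, G (deg j) (h j)) /\ forall x, span_of h x.
Proof.
move=> [s sP].
have [S /choice[c cP]] := choice (gcomp_span G).
pose L := [seq (u, c y u) | y <- s, u <- S y].
pose h (j : 'I_(size L)) := (tnth (in_tuple L) j).2.
exists (size L), h, (fun j => (tnth (in_tuple L) j).1); split=> [j|x].
  rewrite /h; have /allpairsPdep[y [u [_ _ ->]]] := mem_tnth j (in_tuple L).
  by have [] := cP y.
have [q qs ->] := sP x; rewrite big_seq; apply: span_of_sum => t /qs ts.
apply: span_ofZ; have [_ ->] := cP t.2; rewrite big_seq.
apply: span_of_sum => u uS.
have /tnthP[j jE] : (u, c t.2 u) \in in_tuple L by apply: allpairs_f_dep.
have -> : c t.2 u = h j by rewrite /h -jE.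
exact: span_of_gen.
Qed.

(** The graph relates [x] to [y] if [y] has degree [v] and [x - y] is a sum of
    homogeneous elements of other degrees, repetitions allowed. *)
Lemma graded_projection v : exists pr : {linear UA -> UA},
  [/\ forall x, G v (pr x), forall x, G v x -> pr x = x
    & forall u x, u != v -> G u x -> pr x = 0].
Proof.
pose off (L : seq (Zn * U)) := forall t, t \in L -> t.1 != v /\ G t.1 t.2.
pose P (x y : UA) := G v y /\ exists2 L, off L & x = y + \sum_(t <- L) t.2.
have [|||pr prP] := @linear_of_graph _ _ _ P.
- move=> x; have [s [c [Gc ->]]] := gcomp_span G x.
  exists (\sum_(u <- s | u == v) c u); split.
    by apply: gcomp_sum => u /eqP ->.
  exists [seq (u, c u) | u <- s & u != v].
    by move=> t /mapP[u]; rewrite mem_filter => /andP[uv _] ->.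
  by rewrite big_map big_filter [LHS](bigID (fun u => u == v)).
- move=> a x y x' y' [Gy [L offL ->]] [Gy' [L' offL' ->]]; split.
    by apply: gcompD => //; apply: gcompC.
  exists ([seq (t.1, a%:MP *: t.2) | t <- L] ++ L').
    move=> t; rewrite mem_cat => /orP[/mapP[t' /offL[tv Gt] ->]|/offL' //].
    by split=> //; apply: gcompC.
  by rewrite big_cat big_map /= scalerDr scaler_sumr addrACA.
- move=> y [Gy [L offL /esym y0]].
  pose c u := if u == v then y else \sum_(t <- L | t.1 == u) t.2.
  pose s := undup [seq t.1 | t <- L].
  have Gc u : G u (c u).
    rewrite /c; case: eqP => [->|_] //.
    rewrite big_seq_cond; apply: gcomp_sum => t /andP[/offL[_ Gt] /eqP <-].
    exact: Gt.
  have vs : v \notin s.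
    by rewrite mem_undup; apply/mapP => -[t /offL[/eqP tv _]] /esym.
  have us : uniq (v :: s) by rewrite /= vs undup_uniq.
  suff c0 : \sum_(u <- v :: s) c u = 0.
    have := gcomp_direct us Gc c0 (mem_head _ _).
    by rewrite /c eqxx.
  rewrite big_cons /c eqxx -[RHS]y0; congr (_ + _).
  transitivity (\sum_(u <- s) \sum_(t <- L | t.1 == u) t.2).
    rewrite !big_seq; apply: eq_bigr => u us'.
    by case: eqP => // uv; move: vs; rewrite -uv us'.
  rewrite (exchange_big_dep predT) //= big_seq [RHS]big_seq.
  apply: eq_bigr => t tL.
  rewrite (eq_bigl (pred1 t.1)); last by move=> u; exact: eq_sym.
  rewrite -big_filter filter_pred1_uniq ?big_seq1 ?undup_uniq //.
  by rewrite mem_undup map_f.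
exists pr; split=> [x|x Gx|u x uv Gx].
- by have [] : P x (pr x) by apply/prP.
- by apply/esym/prP; split=> //; exists [::] => //; rewrite big_nil addr0.
apply/esym/prP; split; first exact: gcomp0.
exists [:: (u, x)]; last by rewrite big_seq1 add0r.
by move=> t; rewrite inE => /eqP ->.
Qed.

Lemma mnm_degree_inj : injective (@mnm_degree n).
Proof.
move=> m m' mm'; apply/mnmP => i; apply/eqP; rewrite -eqz_nat; apply/eqP.
by have /rowP/(_ i) := mm'; rewrite !mxE.
Qed.

(** Distinct monomials have distinct degrees, so at most one monomial multiple
    of each generator lies in degree [v].  The number of generators of a
    component is therefore bounded independently of [v]. *)
Lemma component_generators r (h : 'I_r -> U) (deg : 'I_r -> Zn) v :
  (forall j, G (deg j) (h j)) -> (forall x, span_of h x) ->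
  exists m : 'I_r -> U, (forall j, G v (m j)) /\
    forall x, G v x -> span_of (m : 'I_r -> UA) x.
Proof.
move=> Gh hspan; have [pr [Gpr pr_id pr0]] := graded_projection v.
have [m mP] : exists m : 'I_r -> U, forall j, G v (m j) /\
    forall g, pr ('X_[g] *: h j) = m j \/ pr ('X_[g] *: h j) = 0.
  suff /choice[m] : forall j, exists m : U, G v m /\
    forall g, pr ('X_[g] *: h j) = m \/ pr ('X_[g] *: h j) = 0 by exists m.
  move=> j; have Gg g : G (mnm_degree g + deg j) ('X_[g] *: h j).
    by apply: gcompZ => //; exact: homogeneousX.
  have [[g gv]|ng] := pselect (exists g, mnm_degree g + deg j = v).
    exists ('X_[g] *: h j); split=> [|g']; first by rewrite -[X in G X]gv.
    have [gg'|gg'] := eqVneq g' g.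
      by left; rewrite gg' pr_id // -[X in G X]gv.
    right; apply: pr0 (Gg g'); apply: contraNneq gg' => g'v.
    by apply/eqP/mnm_degree_inj/(addIr (deg j)); rewrite g'v gv.
  exists 0; split=> [|g]; first exact: gcomp0.
  by right; apply: pr0 (Gg g); apply/eqP => gv; apply: ng; exists g.
exists m; split=> [j|x Gx]; first by case: (mP j).
have [a aE] := hspan x; rewrite -(pr_id x Gx) aE.
rewrite (linear_sum pr); apply: span_of_sum => j _.
rewrite [a j]mpolyE scaler_suml (linear_sum pr); apply: span_of_sum => g _.
rewrite -mul_mpolyC -scalerA (linearZ_LR pr); apply: span_ofZ.
case: (mP j) => _ /(_ g)[->|->]; last exact: span_of0.
exact: (@span_of_gen _ UA).
Qed.

End GradedModules.

Section GradedCyclic.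
Variables (K : fieldType) (n : nat).
Local Notation A := (powser K).
Local Notation R := {mpoly A[n]}.
Local Notation Zn := 'rV[int]_n.
Variables (U : lmodType R) (G : grading U).
Local Notation UA := (restrict (@mpolyC n A) U).

Lemma graded_cyclic_component : fin_gen U ->
  exists r : nat, forall v, exists (w : 'I_r -> U) (d : 'I_r -> A),
    cyclic_component G v w d.
Proof.
move=> /(homogeneous_generators G)[r [h [deg [Gh hspan]]]]; exists r => v.
have [m [Gm mspan]] := component_generators v Gh hspan.
have [pr [Gpr pr_id _]] := graded_projection G v.
have [w [d [wm mw wd]]] := @cyclic_decomposition K UA r m.
have w_span x : G v x -> span_of w x.
  by move=> /mspan; exact: span_of_trans.
have Gw j : G v (w j) by apply: gcomp_span_of (wm j).
have delta j (a : A) : \sum_l (if l == j then a else 0) *: w l = a *: w j.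
  rewrite (bigD1 j) //= eqxx big1 ?addr0 // => l /negbTE ->.
  by rewrite scale0r.
exists w, d; split=> // j.
  rewrite -[LHS]/(d j *: (w j : UA)) -delta; apply/wd => l.
  case: eqP => [->|_]; first by exists 1; rewrite mul1r.
  by exists 0; rewrite mul0r.
pose P (x : UA) (y : cyclic_mod (d j)) := exists2 a : 'I_r -> A,
  pr x = \sum_l a l *: w l & y = cyclic_class (d j) (a j).
have [|||c cP] := @linear_of_graph _ _ _ P.
- move=> x; have [a aE] := w_span _ (Gpr x).
  by exists (cyclic_class (d j) (a j)), a.
- move=> b x y x' y' [a prx ->] [a' prx' ->]; exists (fun l => b * a l + a' l).
    rewrite linearP prx prx' scaler_sumr -big_split; apply: eq_bigr => l _ /=.
    by rewrite scalerDl scalerA.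
  by rewrite cyclic_classD cyclic_classZ.
- move=> y [a]; rewrite linear0 => /esym/wd ad ->.
  exact/cyclic_class_eq0.
exists c => l; apply/esym/cP; exists (fun l' => if l' == l then 1 else 0).
  by rewrite delta scale1r pr_id.
by rewrite eq_sym; case: eqP.
Qed.

End GradedCyclic.

(** * Iterates of the Frobenius functor *)

Section FrobeniusIterates.
Variables (A : comNzRingType) (p n : nat).
Local Notation R := {mpoly A[n]}.
Local Notation Zn := 'rV[int]_n.

Lemma homogeneousM u v (r s : R) :
  homogeneous u r -> homogeneous v s -> homogeneous (u + v) (r * s).
Proof.
move=> hr hs m /msuppM_le/allpairsP[[m1 m2] /= [/hr <- /hs <- ->]].
by apply/rowP => i; rewrite !mxE mnmDE PoszD.
Qed.

Lemma frob_gcomp_closed (W : lmodType R) (G : Zn -> W -> Prop) :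
  graded_closed (@frob_gcomp A n p W G).
Proof.
move=> u v r _ hr [s sP ->]; exists [seq (r * t.1, t.2) | t <- s].
  move=> t /mapP[t' /sP[v' [w [hv Gw <-]]] ->]; exists (u + v'), w.
  by split=> //; [exact: homogeneousM|rewrite addrA].
rewrite big_map scaler_sumr; apply: eq_bigr => t _.
by rewrite /frob_tens -tensZl.
Qed.

Variables (U : lmodType R) (GU : grading U).

Lemma frob_iter_gcomp_closed e :
  graded_closed (@frob_iter_gcomp A n p e U GU).
Proof. by case: e => [|e]; [exact: gcompZ|exact: frob_gcomp_closed]. Qed.

Lemma frob_iter_cyclic (charA : p \in [pchar A]) (r : nat) :
  (forall v, exists (w : 'I_r -> U) (d : 'I_r -> A),
     cyclic_component GU v w d) ->
  forall e u, exists (w : 'I_r -> frob_iter p e U) (d : 'I_r -> A),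
    cyclic_component (@frob_iter_gcomp A n p e U GU) u w
      (fun j => d j ^+ (p ^ e)).
Proof.
move=> Ucyc; elim=> [|e IHe] u.
  by have [w [d wd]] := Ucyc u; exists w, d.
have [w [d wd]] := IHe (floor_degree p u).
have := frob_cyclic_component charA (@frob_iter_gcomp_closed e) wd.
under [fun j => (d j ^+ _) ^+ _]funext do rewrite -exprM -expnSr.
by exists (fun j => frob_tens p 'X_[residue_mnm p u] (w j)), d.
Qed.

Lemma frob_iter_map_degree (beta : {linear U -> frob p U}) :
  (forall u x, GU u x -> frob_gcomp GU u (beta x)) ->
  forall e u x, @frob_iter_gcomp A n p e U GU u x ->
    @frob_iter_gcomp A n p e.+1 U GU u (frob_iter_map beta e x).
Proof.
move=> beta_deg; elim=> [|e IHe] u x; first exact: beta_deg.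
move=> [s sP ->]; exists [seq (t.1, frob_iter_map beta e t.2) | t <- s].
  move=> t /mapP[t' /sP[v [w [hv Gw vw]]] ->]; exists v, w.
  by split=> //; exact: IHe.
rewrite linear_sum big_map; apply: eq_bigr => t _ /=.
exact: tens_mapE.
Qed.

End FrobeniusIterates.

Section CyclicSocle.
Variables (K : fieldType) (n : nat).
Local Notation A := (powser K).
Local Notation R := {mpoly A[n]}.
Local Notation Zn := 'rV[int]_n.
Local Notation Y := (psX K).

Variable W : lmodType R.
Local Notation WA := (restrict (@mpolyC n A) W).

(** In [A / d^(q+1)] with [d = Y d'], the condition [Y a = 0] means that
    [d^(q+1)] divides [Y a], so [Y^q] divides [a]; if [d] is a unit, the summand
    is zero. *)
Lemma cyclic_component_socle (G : Zn -> W -> Prop) u r q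
    (w : 'I_r -> W) (d : 'I_r -> A) (x : WA) :
  cyclic_component G u w (fun j => d j ^+ q.+1) -> G u x -> Y *: x = 0 ->
  exists2 z : WA,
    span_of (w : 'I_r -> WA) z & x = Y ^+ q *: z.
Proof.
move=> [Gw Gspan dw Gc] /Gspan[a ->] Yx.
suff /choice[b bP] : forall j, exists b,
    a j *: (w j : WA) = (Y ^+ q * b) *: (w j : WA).
  exists (\sum_j b j *: (w j : WA)); first by exists b.
  by rewrite scaler_sumr; apply: eq_bigr => j _; rewrite bP scalerA.
move=> j; have dwj : d j ^+ q.+1 *: (w j : WA) = 0 by exact: dw.
have [/nonunit_psX[d' dE]|/eqP] := pselect (coefs (d j) 0 = 0); last first.
  rewrite -unit_psE => ud; exists 0; rewrite mulr0 scale0r.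
  rewrite -[w j in LHS](scale1r (w j : WA)).
  by rewrite -(mulVr (unitrX q.+1 ud)) -scalerA dwj !scaler0.
have [c cP] := Gc j.
have : c (Y *: \sum_l a l *: (w l : WA)) =
    cyclic_class (d j ^+ q.+1) (Y * a j).
  rewrite linearZ linear_sum cyclic_classZ /=; congr (_ *: _).
  rewrite (bigD1 j) //= big1 ?addr0 => [|l lj].
    by rewrite linearZ /= cP eqxx -cyclic_classZ mulr1.
  by rewrite linearZ /= cP (negbTE lj) cyclic_class0 scaler0.
rewrite Yx linear0 => /esym/cyclic_class_eq0[t].
rewrite dE exprMn exprS -mulrA [RHS]mulrCA => YaE.
exists (t * d' ^+ q.+1); congr (_ *: _); apply: (mulfI (psX_neq0 K)).
by rewrite YaE; congr (_ * _); exact: mulrCA.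
Qed.

End CyclicSocle.

(** * Elements of direct limits *)

Section Threads.
Variables (R : comNzRingType) (X : nat -> lmodType R).
Variable t : forall e, {linear X e -> X e.+1}.

(** The product of the [X e]; its quotient by the sequences that vanish from
    some index on receives a compatible family of maps from the [X e]. *)
Definition dep_seq : Type := forall e, X e.

HB.instance Definition _ := gen_eqMixin dep_seq.
HB.instance Definition _ := gen_choiceMixin dep_seq.

Let dep_seqP (f g : dep_seq) : (forall e, f e = g e) -> f = g.
Proof. exact: functional_extensionality_dep. Qed.

Definition dep_seq_add (f g : dep_seq) : dep_seq := fun e => f e + g e.
Definition dep_seq_opp (f : dep_seq) : dep_seq := fun e => - f e.
Definition dep_seq_zero : dep_seq := fun e => 0.
Definition dep_seq_scale (a : R) (f : dep_seq) : dep_seq := fun e => a *: f e.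

Fact dep_seq_addA : associative dep_seq_add.
Proof. by move=> f g h; apply: dep_seqP => e; exact: addrA. Qed.
Fact dep_seq_addC : commutative dep_seq_add.
Proof. by move=> f g; apply: dep_seqP => e; exact: addrC. Qed.
Fact dep_seq_add0 : left_id dep_seq_zero dep_seq_add.
Proof. by move=> f; apply: dep_seqP => e; exact: add0r. Qed.
Fact dep_seq_addN : left_inverse dep_seq_zero dep_seq_opp dep_seq_add.
Proof. by move=> f; apply: dep_seqP => e; exact: addNr. Qed.

HB.instance Definition _ :=
  GRing.isZmodule.Build dep_seq
    dep_seq_addA dep_seq_addC dep_seq_add0 dep_seq_addN.

Fact dep_seq_scaleA a b f :
  dep_seq_scale a (dep_seq_scale b f) = dep_seq_scale (a * b) f.
Proof. by apply: dep_seqP => e; exact: scalerA. Qed.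
Fact dep_seq_scale1 : left_id 1 dep_seq_scale.
Proof. by move=> f; apply: dep_seqP => e; exact: scale1r. Qed.
Fact dep_seq_scaleDr : right_distributive dep_seq_scale +%R.
Proof. by move=> a f g; apply: dep_seqP => e; exact: scalerDr. Qed.
Fact dep_seq_scaleDl f : {morph dep_seq_scale^~ f : a b / a + b}.
Proof. by move=> a b; apply: dep_seqP => e; exact: scalerDl. Qed.

HB.instance Definition _ := GRing.Zmodule_isLmodule.Build R dep_seq
  dep_seq_scaleA dep_seq_scale1 dep_seq_scaleDr dep_seq_scaleDl.

(** The images of [x] in all later [X e]; earlier values are arbitrary. *)
Definition thread (e : nat) (x : X e) (f : dep_seq) : Prop :=
  f e = x /\ forall e', (e <= e')%N -> f e'.+1 = t e' (f e').

Fixpoint thread_from (e : nat) (x : X e) (e' : nat) : X e' :=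
  match e =P e' with
  | ReflectT ee' => ecast i (X i) ee' x
  | ReflectF _ => if e' is k.+1 then t k (thread_from x k) else 0
  end.

Lemma thread_exists (e : nat) (x : X e) : exists f, thread x f.
Proof.
exists (thread_from x); split=> [|e' ee'].
  by case: e x => [|e] x /=; case: eqP => // ee; rewrite eq_axiomK.
rewrite /=; case: eqP => // e_eq; by rewrite e_eq ltnn in ee'.
Qed.

Definition eventually0 (f : dep_seq) : Prop :=
  exists k, forall e, (k <= e)%N -> f e = 0.

Lemma lspan_eventually0 f : lspan eventually0 f -> eventually0 f.
Proof.
move=> [s sP ->]; rewrite big_seq; apply: (big_ind eventually0).
- by exists 0%N.
- move=> g h [k gk] [l hl]; exists (maxn k l) => e.
  rewrite geq_max => /andP[ke le].
  by rewrite -[LHS]/(g e + h e) gk // hl // addr0.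
move=> u /sP[k uk]; exists k => e ke.
by rewrite -[LHS]/(u.1 *: u.2 e) uk // scaler0.
Qed.

(** The universal property is tested on the product modulo eventually vanishing
    sequences, where the class of [x] is that of its thread.  This makes the
    usual description of the kernel of [X e -> M] available for a limit known
    by its universal property only. *)
Lemma direct_limit_eq0 (M : lmodType R) (iota : forall e, {linear X e -> M}) :
  is_direct_limit t iota -> forall e (x : X e) f,
    thread x f -> iota e x = 0 -> eventually0 f.
Proof.
move=> [_ univ] e x f xf ix0.
pose Q := lquot eventually0.
have [g gP] : exists g : forall e, {linear X e -> Q},
    forall e (x : X e) f, thread x f -> g e x = lquot_pi eventually0 f.
  suff G e' : exists g : {linear X e' -> Q},
      forall (x : X e') f, thread x f -> g x = lquot_pi eventually0 f.
    exists (fun e => sval (cid (G e))) => e' x' f' xf'.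
    by case: (cid (G e')) => g gP /=; apply: gP.
  pose P (x : X e') (y : Q) :=
    exists2 f, thread x f & y = lquot_pi eventually0 f.
  have [|||g gP] := @linear_of_graph _ _ _ P.
  - move=> x'; have [f' xf'] := thread_exists x'.
    by exists (lquot_pi eventually0 f'), f'.
  - move=> a x1 y1 x2 y2 [f1 [fx1 ft1] ->] [f2 [fx2 ft2] ->].
    exists (a *: f1 + f2); last by rewrite linearP.
    split=> [|l el]; first by rewrite -fx1 -fx2.
    rewrite -[LHS]/(a *: f1 l.+1 + f2 l.+1) ft1 // ft2 //.
    by rewrite -linearP.
  - move=> y [f' [f'0 f't] ->]; rewrite -[RHS](linear0 (lquot_pi eventually0)).
    apply/lquot_piP; apply: lspan_gen; rewrite subr0; exists e' => l.
    move=> /subnK <-; elim: (l - e')%N => [|k IHk] //.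
    by rewrite addSn f't ?leq_addl // IHk linear0.
  exists g => x' f' xf'; apply/esym/gP; by exists f'.
have [|h [hP _]] := univ Q g.
  move=> e' x'; have [f' xf'] := thread_exists x'.
  rewrite (gP _ _ _ xf'); apply: gP; case: xf' => <- f't; split=> [|l el].
    exact: f't.
  by apply: f't; exact: ltnW.
have : g e x = 0 by rewrite -hP ix0 linear0.
rewrite (gP _ _ _ xf) -[RHS](linear0 (lquot_pi eventually0)) => /lquot_piP.
by rewrite subr0; exact: lspan_eventually0.
Qed.

Lemma thread_scale (a : R) e (x : X e) f :
  thread x f -> thread (a *: x) (a *: f).
Proof.
move=> [<- ft]; split=> // e' ee'.
by rewrite -[LHS]/(a *: f e'.+1) ft // -linearZ.
Qed.

Lemma thread_limit (M : lmodType R) (iota : forall e, {linear X e -> M}) :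
  is_direct_limit t iota -> forall e (x : X e) f, thread x f ->
  forall e', (e <= e')%N -> iota e' (f e') = iota e x.
Proof.
move=> [it _] e x f [<- ft] e' /subnK <-; elim: (e' - e)%N => [|k IHk] //.
by rewrite addSn ft ?leq_addl // it.
Qed.

End Threads.

(** * Components of the limit *)

Section LimitComponent.
Variables (K : fieldType) (p n : nat).
Local Notation A := (powser K).
Local Notation R := {mpoly A[n]}.
Local Notation Y := (psX K).
Hypothesis charK : p \in [pchar K].
Variables (M : fmodule R p) (G : grading M) (u : 'rV[int]_n).
Variables (U : lmodType R) (GU : grading U) (beta : {linear U -> frob p U}).
Variable iota : forall e, {linear frob_iter p e U -> M}.
Hypothesis U_fg : fin_gen U.
Hypothesis beta_deg : forall u x, GU u x -> frob_gcomp GU u (beta x).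
Hypothesis M_limit : is_direct_limit (frob_iter_map beta) iota.
Hypothesis G_limit : forall u m, G u m <->
  exists e (x : frob_iter p e U),
    @frob_iter_gcomp A n p e U GU u x /\ m = iota e x.

Local Notation Ge e := (@frob_iter_gcomp A n p e U GU u).
Local Notation FA e := (restrict (@mpolyC n A) (frob_iter p e U)).
Local Notation MA := (restrict (@mpolyC n A) M).

(** An element of [M_u] is represented at all late stages, in degree [u], and
    whatever kills it in the limit kills its late representatives. *)
Lemma component_thread (m : component G u) :
  exists e (f : dep_seq (fun e => frob_iter p e U)),
  (forall e', (e <= e')%N -> Ge e' (f e') /\ iota e' (f e') = val m) /\
  forall a, a *: m = 0 -> exists k, forall e', (k <= e')%N ->
    a *: (f e' : FA e') = 0.
Proof.
have /asboolP/G_limit[e [x [Gx mE]]] := valP m.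
have [f xf] := thread_exists (frob_iter_map beta) x; exists e, f; split.
  move=> e' ee'; split; last by rewrite (thread_limit M_limit xf ee') mE.
  have [fe ft] := xf; move: ee' => /subnK <-.
  elim: (e' - e)%N => [|k IHk]; first by rewrite fe.
  by rewrite addSn ft ?leq_addl //; exact: frob_iter_map_degree.
move=> a am0; apply: (direct_limit_eq0 M_limit (thread_scale a%:MP xf)).
by rewrite linearZ /= -mE; exact: (congr1 val am0).
Qed.

Let cyclic : exists r, forall e u,
  exists (w : 'I_r -> frob_iter p e U) (d : 'I_r -> A),
    cyclic_component (@frob_iter_gcomp A n p e U GU) u w
      (fun j => d j ^+ (p ^ e)).
Proof.
have [r Ucyc] := graded_cyclic_component GU U_fg; exists r.
by have := frob_iter_cyclic (pchar_powser charK) Ucyc.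
Qed.

(** Finitely many elements of [M_u] are represented at a common stage, where [r]
    elements generate the component. *)
Lemma component_relations :
  exists r, unit_relations r (fun _ : component G u => True).
Proof.
have [r cyc_e] := cyclic; exists r => x _.
have [e /choice[f fP]] := choice (fun j => component_thread (x j)).
pose k := \max_j e j; have [w [d [_ w_span _ _]]] := cyc_e k u.
have [j|a [a0 ua]] := @unit_relation_span K r (FA k) w (fun j => f j k).
  by apply: w_span; have [/(_ k (leq_bigmax j))[]] := fP j.
exists a; split=> //; apply: val_inj; rewrite (raddf_sum val) /=.
transitivity (iota k (\sum_j a j *: (f j k : FA k))); last first.
  by rewrite a0 linear0.
rewrite (linear_sum (iota k)); apply: eq_bigr => j _.
have [/(_ k (leq_bigmax j))[_ <-] _] := fP j.
exact/esym/(linearZ_LR (iota k)).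
Qed.

(** At a late stage [e] the representative is killed by [Y], hence divisible by
    [Y^(p^e - 1)], and [p^e - 1 >= e] exceeds any given bound. *)
Lemma component_socle_divisible (m : component G u) : Y *: m = 0 ->
  forall k, exists m', m = Y ^+ k *: m'.
Proof.
move=> Ym k; have [e [f [fP /(_ _ Ym)[l fl]]]] := component_thread m.
have [r cyc_e] := cyclic.
pose e' := maxn k (maxn e l).
have [Gf ie] := fP e' (leq_trans (leq_maxl _ _) (leq_maxr _ _)).
have Yf := fl e' (leq_trans (leq_maxr _ _) (leq_maxr _ _)).
have p_gt1 : (1 < p)%N by apply: prime_gt1; case/andP: charK.
have [w [d wd]] := cyc_e e' u.
have ke' : (k < p ^ e')%N.
  by apply: leq_ltn_trans (ltn_expl _ p_gt1); exact: leq_maxl.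
move: ke' wd; case: (p ^ e')%N => // q; rewrite ltnS => kq wd.
have [z [b zE] fE] := cyclic_component_socle wd Gf Yf.
have [Gw _ _ _] := wd.
pose m0 : MA := Y ^+ (q - k) *: (iota e' z : MA).
have Gm0 : gcomp_pred G u m0.
  apply/asboolP; apply: gcompC; rewrite zE (linear_sum (iota e')).
  apply: gcomp_sum => j _; rewrite (linearZ_LR (iota e')); apply: gcompC.
  by apply/G_limit; exists e', (w j).
exists (Sub m0 Gm0 : component_type G u); apply: val_inj.
rewrite -ie fE (linearZ_LR (iota e')) -[LHS]/(Y ^+ q *: (iota e' z : MA)).
by rewrite -{1}(subnKC kq) exprD -scalerA.
Qed.

End LimitComponent.

Theorem theoremD (K : fieldType) (p : nat) (charKp : p \in [pchar K]) (n : nat)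
    (M : fmodule {mpoly (powser K)[n]} p) (G : grading M)
    (M_graded_F_finite : graded_F_finite G)
    (E : lmodType (powser K)) (i : {linear residue_module K -> E})
    (E_hull : is_injective_hull i) :
  forall u : 'rV[int]_n, exists a b c : nat,
    lmod_iso (component G u)
      ({ffun 'I_a -> E} * {ffun 'I_b -> fraction_module K} *
       {ffun 'I_c -> (powser K)^o})%type.
Proof.
case: M_graded_F_finite => U [GU [beta [iota [U_fg beta_deg [M_lim _] G_lim]]]].
move=> u.
have [r rel] := component_relations charKp u U_fg beta_deg M_lim G_lim.
apply: (divisible_torsion_decomposition E_hull _ rel).
exact: (component_socle_divisible charKp U_fg beta_deg M_lim G_lim).
Qed.
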